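(* Let $\varphi$ be a nonnegative function in $L^1_{\rm loc}(0,\infty)$ such that $H_\varphi$ is bounded on $\mathcal H^1(\mathbb R)$. Then $$\int_0^\infty\varphi(t)\,dt\le\|H_\varphi\|_{\mathcal H^1(\mathbb R)\to\mathcal H^1(\mathbb R)}<\infty .$$
   Context: The Hausdorff operator is $H_\varphi f(x)=\int_0^\infty f\left(\frac xt\right)\frac{\varphi(t)}{t}\,dt$, $x\in\mathbb R$. ''$H_\varphi$ is bounded on $\mathcal H^1(\mathbb R)$'' means that for every $f\in\mathcal H^1(\mathbb R)$ this integral exists for a.e. $x$ and $H_\varphi$ is a bounded linear operator from $\mathcal H^1(\mathbb R)$ to itself. Real Hardy space: fix a Schwartz function $\Phi\in\mathcal S(\mathbb R)$ with $\int_{\mathbb R}\Phi(x)\,dx\neq0$, and put $\Phi_t(x)=t^{-1}\Phi(x/t)$ for $t>0$. Then $\mathcal H^1(\mathbb R)$ is the set of all $f\in L^1(\mathbb R)$ with $\|f\|_{\mathcal H^1(\mathbb R)}:=\|M_\Phi(f)\|_{L^1(\mathbb R)}<\infty$, where $M_\Phi(f)(x)=\sup_{t>0}|f*\Phi_t(x)|$. The space does not depend on $\Phi$, although the norm does. *)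

(* Defs.v *)
From mathcomp Require Import all_boot all_order all_algebra.
From mathcomp Require Import all_classical all_reals all_analysis.
From mathcomp Require Import complex.

Set Implicit Arguments.
Unset Strict Implicit.
Unset Printing Implicit Defensive.

Import Order.TTheory GRing.Theory Num.Theory.
Import numFieldNormedType.Exports.

Local Open Scope classical_set_scope.
Local Open Scope ring_scope.
Local Open Scope complex_scope.

(* MathComp-Analysis integrates real and extended-real functions only, so
   measurability, integrability, integration and differentiation of
   complex-valued functions of a real variable are taken on real and imaginary
   parts.  Elements of L^1 are represented by Borel measurable functions, which
   exist in every Lebesgue class; all notions below are invariant under
   a.e. equality. *)
Section Hardy.
Context (R : realType).
Implicit Types (f g Phi : R -> R[i]) (phi h : R -> R) (D : set R).

Local Notation mu := (@lebesgue_measure R).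

(* [normc z] is the modulus as an element of [R]; [`|z|] lives in [R[i]]. *)
Local Notation normc := (@Normc.normc R).

Definition cintegrable D f : Prop :=
  mu.-integrable D (fun x => (complex.Re (f x))%:E) /\
  mu.-integrable D (fun x => (complex.Im (f x))%:E).

Definition cintegral D f : R[i] :=
  Rintegral mu D (fun x => complex.Re (f x)) +i*
  Rintegral mu D (fun x => complex.Im (f x)).

Definition rschwartz h : Prop :=
  (forall n x, derivable (derive1n n h) x 1) /\
  (forall k n : nat, exists C : R, forall x, `|x| ^+ k * `|derive1n n h x| <= C).

Definition schwartz Phi : Prop :=
  rschwartz (fun x => complex.Re (Phi x)) /\
  rschwartz (fun x => complex.Im (Phi x)).

Definition dilation Phi (t : R) : R -> R[i] :=
  fun x => (t^-1)%:C * Phi (x / t).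

Definition convolution f g (x : R) : R[i] :=
  cintegral setT (fun y => f y * g (x - y)).

Definition maximal Phi f (x : R) : \bar R :=
  ereal_sup [set (normc (convolution f (dilation Phi t) x))%:E | t in `]0, +oo[].

Definition hardy_norm Phi f : \bar R := \int[mu]_x maximal Phi f x.

Definition hardy Phi : set (R -> R[i]) :=
  [set f | cintegrable setT f /\ (hardy_norm Phi f < +oo)%E].

Definition hausdorff_integrand phi f (x t : R) : R[i] :=
  f (x / t) * (phi t / t)%:C.

(* A junk value occurs where the integrand is not integrable; this matters only
   on a null set once [hausdorff_bounded] holds. *)
Definition hausdorff phi f (x : R) : R[i] :=
  cintegral `]0, +oo[ (hausdorff_integrand phi f x).

Record hausdorff_bounded Phi phi : Prop := HausdorffBounded {
  hausdorff_ae_defined : forall f, hardy Phi f ->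
    {ae mu, forall x, cintegrable `]0, +oo[ (hausdorff_integrand phi f x)} ;
  hausdorff_hardy : forall f, hardy Phi f -> hardy Phi (hausdorff phi f) ;
  hausdorff_linear : forall (a : R[i]) f g, hardy Phi f -> hardy Phi g ->
    {ae mu, forall x, hausdorff phi (fun y => a * f y + g y) x =
                      a * hausdorff phi f x + hausdorff phi g x} ;
  hausdorff_continuous : exists C : R, forall f, hardy Phi f ->
    (hardy_norm Phi (hausdorff phi f) <= C%:E * hardy_norm Phi f)%E
}.

Definition hausdorff_opnorm Phi phi : \bar R :=
  ereal_sup [set hardy_norm Phi (hausdorff phi f) |
             f in [set f | hardy Phi f /\ (hardy_norm Phi f <= 1)%E]].

End Hardy.

(* Main.v *)
Require Import Defs.
From mathcomp Require Import all_boot all_order all_algebra.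
From mathcomp Require Import all_classical all_reals all_analysis.
From mathcomp Require Import complex.
From mathcomp Require Import measurable_realfun ring lra.

Set Implicit Arguments.
Unset Strict Implicit.
Unset Printing Implicit Defensive.

Import Order.TTheory GRing.Theory Num.Theory.
Import numFieldNormedType.Exports.

Local Open Scope classical_set_scope.
Local Open Scope ring_scope.

(** Let [D s f x = s^-1 * f (x / s)].  The Hausdorff operator [T] is the average
    of the dilations [D t] with density [phi], and every [D s] preserves the
    Hardy norm because maximal functions commute with dilations
    ([supconv_norm_dilate]).  The lower bound says that nothing cancels in this
    average: the dilations form an amenable group, hence there are vectors
    which they all almost fix, and [T] acts on these almost as the scalar
    [int phi].

    The almost fixed vectors are [f_N x = 1 / x] for [1 <= |x| < N]
    ([truncinv]).  If [u x = 1 / x] for [1 <= |x|], then [f_N = u - D N u], so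
    linearity gives [T f_N - (int phi) f_N = G - D N G] with
    [G = T u - (int phi) u].  When [phi] is supported in a compact subset of
    the open half-line, [G] is odd, bounded and of compact support; such
    functions have finite Hardy norm ([supconv_norm_atom]), and the norm of the
    difference is at most [2 ||G||] for every [N]
    ([supconv_norm_rhausdorff_almost_eigen]).  On the other hand the norm of
    [f_N] is at least [c ln N], because a maximal function is at least a
    fixed positive multiple of [|f|] at the continuity points of [f]
    ([supconv_norm_truncinv_ge]).  Dividing by the norm of [f_N] and letting
    [N] tend to infinity gives [int phi <= ||T||] for such [phi].

    In general [phi] is cut off to [[1/K, K]].  The operator of the remaining
    tail has norm at most the integral of the tail, by the integral inequality
    of Minkowski ([supconv_norm_rhausdorff]), and this integral tends to [0]
    provided that [phi] is integrable.  Integrability comes first, and from a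
    single function: [T f_2] is integrable and nonnegative on the positive
    half-line, and by the theorem of Tonelli its integral there is a positive
    multiple of [int phi] ([integrable_of_rhausdorff]).

    All test functions are real.  Since [|z|] is the supremum of
    [a Re z + b Im z] over the unit disc, the maximal function of a real
    function is a supremum of real convolutions with a family of real kernels
    stable under dilation and change of sign ([maximal_complexify]), and the
    whole argument is carried out for such families ([kernel_family]). *)

(** * Affine changes of variables in Lebesgue integrals *)

Section affine_change_of_variables.
Context (R : realType).
Local Notation mu := (@lebesgue_measure R).
Implicit Types (a b : R).

Lemma measurable_affine a b :
  measurable_fun setT (fun x : measurableTypeR R => a * x + b : measurableTypeR R).
Proof.
by apply: measurable_funD => //; apply: measurable_funM.
Qed.

(** Both sides are measures in [A], so it suffices to compare them on half-open
    intervals, whose preimages are intervals closed on the other side when [a]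
    is negative. *)
Lemma lebesgue_measure_affine a b (A : set (measurableTypeR R)) :
  a != 0 -> measurable A ->
  pushforward mu (fun x : measurableTypeR R => a * x + b : measurableTypeR R) A =
  (`|a|^-1%:E * mu A)%E.
Proof.
move=> a0 mA.
have na : 0 < `|a| by rewrite normr_gt0.
have na0 : 0 <= `|a| by [].
have mf := measurable_affine a b.
set f := fun x : measurableTypeR R => a * x + b : measurableTypeR R.
unshelve epose (pm := (pushforward mu f : {measure set (measurableTypeR R) -> \bar R})).
  exact: measurable_affine.
suff -> : mu A = mscale (NngNum na0) pm A.
  by rewrite /mscale/= muleA -EFinM mulVf ?mul1e// gt_eqF.
apply: lebesgue_measure_unique mA => //= _ [[x y]] _ <-.
rewrite /mscale/= /pm/= /pushforward /f.
have [a_gt0|a_lt0|/eqP] := ltgtP 0 a; last by rewrite eq_sym (negbTE a0).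
- have -> : (fun z => a * z + b) @^-1` `]x, y]%classic =
              `](x - b) / a, (y - b) / a]%classic.
    by apply/seteqP; split => z /=;
      rewrite !in_itv/= ltr_pdivrMr// ler_pdivlMr// (mulrC z) ltrBlDr lerBrDr.
  rewrite !lebesgue_measure_itv/= !lte_fin ltr_pM2r ?invr_gt0// ltrD2r.
  case: ifP => _; last by rewrite mule0.
  by rewrite -?EFinN -!EFinD -EFinM gtr0_norm//; congr (_%:E); field.
- have -> : (fun z => a * z + b) @^-1` `]x, y]%classic =
              `[(y - b) / a, (x - b) / a[%classic.
    by apply/seteqP; split => z /=;
      rewrite !in_itv/= ltr_ndivlMr// ler_ndivrMr// (mulrC z) ltrBlDr lerBrDr//;
      move=> /andP[-> ->].
  rewrite !lebesgue_measure_itv/= !lte_fin ltr_nM2r ?invr_lt0// ltrD2r.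
  case: ifP => _; last by rewrite mule0.
  by rewrite -?EFinN -!EFinD -EFinM ltr0_norm//; congr (_%:E); field; rewrite lt_eqF.
Qed.

Lemma ge0_integral_affine a b (f : R -> \bar R) : a != 0 ->
  measurable_fun setT f -> (forall x, 0 <= f x)%E ->
  (\int[mu]_x f (a * x + b)%R = `|a|^-1%:E * \int[mu]_x f x)%E.
Proof.
move=> a0 mf f0.
have na0 : 0 <= `|a|^-1 by [].
pose g (x : measurableTypeR R) : measurableTypeR R := a * x + b.
transitivity (\int[pushforward mu g]_x f x)%E.
  rewrite ge0_integral_pushforward//=; exact: measurable_affine.
transitivity (\int[mscale (NngNum na0) mu]_x f x)%E.
  apply: eq_measure_integral => //; first exact: measurable_affine.
  move=> mf1 A mA _; exact: lebesgue_measure_affine.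
by rewrite ge0_integral_mscale.
Qed.

Lemma integrable_affine a b (f : R -> R) : a != 0 ->
  mu.-integrable setT (EFin \o f) ->
  mu.-integrable setT (fun x => (f (a * x + b))%:E).
Proof.
move=> a0 /integrableP[mf fi]; apply/integrableP; split.
  by apply: (measurableT_comp mf); exact: measurable_affine.
rewrite (ge0_integral_affine b (f := fun x => `|(f x)%:E|)%E a0)//.
- by rewrite lte_mul_pinfty.
- exact: measurableT_comp.
Qed.

Lemma Rintegral_affine a b (f : R -> R) : a != 0 ->
  mu.-integrable setT (EFin \o f) ->
  \int[mu]_x f (a * x + b) = `|a|^-1 * \int[mu]_x f x.
Proof.
move=> a0 fi; have fi' := integrable_affine b a0 fi.
have mf := measurable_int _ fi.
rewrite /Rintegral [in LHS]integralE [in RHS]integralE.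
transitivity (fine (`|a|^-1%:E * \int[mu]_x ((EFin \o f)^\+)%E x -
                    `|a|^-1%:E * \int[mu]_x ((EFin \o f)^\-)%E x)%E).
  congr (fine (_ - _)).
    rewrite -(ge0_integral_affine b a0)//.
      by apply: eq_integral => x _; rewrite !funeposE.
    exact: (measurable_funepos mf).
  rewrite -(ge0_integral_affine b a0)//.
    by apply: eq_integral => x _; rewrite !funenegE.
  exact: (measurable_funeneg mf).
rewrite -muleBr//; last first.
  by apply: fin_num_adde_defr; exact: integrable_pos_fin_num.
rewrite fineM//.
by rewrite fin_numB integrable_pos_fin_num// integrable_neg_fin_num.
Qed.

End affine_change_of_variables.

(** * Maximal functions of families of kernels *)

Section maximal_functions.
Context (R : realType).
Local Notation mu := (@lebesgue_measure R).
Local Notation L1 f := (mu.-integrable setT (EFin \o f)).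
Implicit Types (f g k : R -> R) (S : set (R -> R)).

Lemma integrable_measurable f : L1 f -> measurable_fun setT f.
Proof. by move=> fi; apply/measurable_EFinP; exact: (measurable_int mu fi). Qed.

Lemma integrable_dominated f g : measurable_fun setT f ->
  (forall x, `|f x| <= g x) -> L1 g -> L1 f.
Proof.
move=> mf fg; apply: le_integrable => //; first exact/measurable_EFinP.
by move=> x _ /=; rewrite lee_fin (le_trans (fg x))// ler_norm.
Qed.

Lemma integrable_bounded_mul f g C : L1 f -> measurable_fun setT g ->
  (forall x, `|g x| <= C) -> L1 (fun x => f x * g x).
Proof.
move=> fi mg gC.
have Ci : L1 (fun x => C * `|f x|).
  by apply: eq_integrable (integrableZl measurableT C (integrable_norm fi)) => //.
apply: integrable_dominated Ci => [|x].
  apply: measurable_funM => //; exact: integrable_measurable.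
by rewrite normrM mulrC ler_wpM2r.
Qed.

Lemma integrable_scale f c : L1 f -> L1 (fun x => c * f x).
Proof. by move=> fi; apply: eq_integrable (integrableZl measurableT c fi). Qed.

Lemma integrable_add f g : L1 f -> L1 g -> L1 (fun x => f x + g x).
Proof. by move=> fi gi; apply: eq_integrable (integrableD measurableT fi gi). Qed.

Lemma lipschitz_continuous f (L : R) :
  (forall x y, `|f x - f y| <= L * `|x - y|) -> continuous f.
Proof.
move=> HL x.
have L0 : 0 <= L.
  by have := HL 1 0; rewrite subr0 normr1 mulr1; apply: le_trans.
apply/cvgrPdist_lt => e e0; near=> y.
apply: (le_lt_trans (HL x y)).
apply: (@le_lt_trans _ _ ((L + 1) * `|x - y|)).
  by rewrite ler_wpM2r// lerDl.
rewrite mulrC -ltr_pdivlMr ?ltr_wpDl//.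
near: y; apply: (@cvgr_dist_lt _ _ _ (nbhs x) _ id) => //.
by rewrite divr_gt0// ltr_wpDl.
Unshelve. all: by end_near. Qed.

Definition conv f k (x : R) : R := \int[mu]_y (f y * k (x - y)).

Definition supconv S f (x : R) : \bar R := ereal_sup [set (conv f k x)%:E | k in S].

Definition supconv_norm S f : \bar R := \int[mu]_x supconv S f x.

Definition dilate (s : R) f : R -> R := fun x => s^-1 * f (x / s).

(** The properties of the dilates of a Schwartz function on which the argument
    rests.  The bound and the Lipschitz constant may depend on the kernel: they
    only serve the integrability and the continuity of convolutions.  The
    constants of [kernel_L1] and [kernel_smooth] are uniform, because both
    conditions are invariant under dilation. *)
Record kernel_family S : Prop := {
  kernel_bounded : forall k, S k -> exists L, forall x, `|k x| <= L ;
  kernel_lipschitz : forall k, S k -> exists L, forall x y, `|k x - k y| <= L * `|x - y| ;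
  kernel_opp : forall k, S k -> S (fun x => - k x) ;
  kernel_dilate : forall k s, S k -> 0 < s -> S (dilate s k) ;
  kernel_L1 : exists P, forall k, S k -> L1 k /\ \int[mu]_x `|k x| <= P ;
  kernel_smooth : exists C, forall k x y, S k -> 2 * `|y| <= `|x| ->
    `|k (x - y) - k x| <= C * `|y| / x ^+ 2 ;
  kernel_mass : exists2 k, S k & 0 < \int[mu]_x k x }.

Section kernel_family.
Variables (S : set (R -> R)) (HS : kernel_family S).

Lemma kernel_continuous k : S k -> continuous k.
Proof. by move=> /(kernel_lipschitz HS)[L HL]; exact: lipschitz_continuous HL. Qed.

Lemma kernel_measurable k : S k -> measurable_fun setT k.
Proof. by move=> Sk; apply: continuous_measurable_fun; exact: kernel_continuous. Qed.

Lemma kernel_shift_measurable k (x : R) : S k ->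
  measurable_fun setT (fun y : R => k (x - y)).
Proof.
move=> Sk; apply: (measurableT_comp (kernel_measurable Sk)).
by apply: measurable_funB.
Qed.

Lemma conv_integrable f k (x : R) : L1 f -> S k -> L1 (fun y => f y * k (x - y)).
Proof.
move=> fi Sk; have [C kC] := kernel_bounded HS Sk.
by apply: (@integrable_bounded_mul _ _ C) => //; exact: kernel_shift_measurable.
Qed.

Lemma convD f g k x : L1 f -> L1 g -> S k ->
  conv (fun y => f y + g y) k x = conv f k x + conv g k x.
Proof.
move=> fi gi Sk; rewrite /conv -RintegralD//; [|exact: conv_integrable..].
by apply: eq_Rintegral => y _; rewrite mulrDl.
Qed.

Lemma convZ f k c x : L1 f -> S k -> conv (fun y => c * f y) k x = c * conv f k x.
Proof.
move=> fi Sk; rewrite /conv -RintegralZl//; last exact: conv_integrable.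
by apply: eq_Rintegral => y _; rewrite mulrA.
Qed.

Lemma convNr f k x : L1 f -> S k -> conv f (fun y => - k y) x = - conv f k x.
Proof.
move=> fi Sk; rewrite -mulN1r /conv -RintegralZl//; last exact: conv_integrable.
by apply: eq_Rintegral => y _; rewrite mulN1r mulrN.
Qed.

Lemma conv_dist f k x y L : L1 f -> S k ->
  (forall x y, `|k x - k y| <= L * `|x - y|) ->
  `|conv f k x - conv f k y| <= L * (\int[mu]_z `|f z|) * `|x - y|.
Proof.
move=> fi Sk HL.
have hi z := conv_integrable z fi Sk.
rewrite /conv -RintegralB//.
have ->: L * (\int[mu]_z `|f z|) * `|x - y| = \int[mu]_z (L * `|x - y| * `|f z|).
  by rewrite RintegralZl// ?(integrable_norm fi)// mulrAC.
have di : L1 (fun z => f z * k (x - z) - f z * k (y - z)).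
  by apply: eq_integrable (integrableB measurableT (hi x) (hi y)) => //.
apply: (le_trans (le_normr_Rintegral _ di)) => //.
apply: le_Rintegral => //.
- exact: integrable_norm di.
- exact: (integrable_scale _ (integrable_norm fi)).
- move=> z _; rewrite -mulrBr normrM mulrC ler_wpM2r//.
  by have := HL (x - z) (y - z); rewrite opprB addrA subrK.
Qed.

Lemma conv_continuous f k : L1 f -> S k -> continuous (conv f k).
Proof.
move=> fi Sk; have [L HL] := kernel_lipschitz HS Sk.
by apply: lipschitz_continuous => x y; exact: conv_dist HL.
Qed.

(** Stability under change of sign makes absolute values superfluous in the
    definition of [supconv]. *)
Lemma le_supconv f k x : L1 f -> S k -> (`|conv f k x|%:E <= supconv S f x)%E.
Proof.
move=> fi Sk; have [h|h] := leP 0 (conv f k x).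
  by rewrite ger0_norm//; apply: ereal_sup_ubound; exists k.
rewrite ltr0_norm// -convNr//; apply: ereal_sup_ubound.
by exists (fun y => - k y) => //; exact: kernel_opp.
Qed.

Lemma supconv_ge0 f x : L1 f -> (0 <= supconv S f x)%E.
Proof.
move=> fi; have [k Sk _] := kernel_mass HS.
by apply: le_trans (le_supconv x fi Sk); rewrite lee_fin.
Qed.

(** A supremum of continuous functions, over an index set of any size, is lower
    semicontinuous. *)
Lemma measurable_supconv f : L1 f -> measurable_fun setT (supconv S f).
Proof.
move=> fi; apply: lower_semicontinuous_measurable => x a.
move=> /ereal_sup_gt[_ [k Sk <-]]; rewrite lte_fin => ak.
exists [set y | a < conv f k y].
  by have := conv_continuous fi Sk; move/(_ x)/cvgr_gt; exact.
move=> y /= ay; apply: (@lt_le_trans _ _ (conv f k y)%:E); rewrite ?lte_fin//.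
by apply: ereal_sup_ubound; exists k.
Qed.

Lemma supconvD f g (x : R) : L1 f -> L1 g ->
  (supconv S (fun y => f y + g y)%R x <= supconv S f x + supconv S g x)%E.
Proof.
move=> fi gi; apply: ge_ereal_sup => _ [k Sk <-].
rewrite convD// EFinD leeD//; apply: ereal_sup_ubound; by exists k.
Qed.

Lemma supconvZ_le f c (x : R) : L1 f ->
  (supconv S (fun y => c * f y)%R x <= `|c|%:E * supconv S f x)%E.
Proof.
move=> fi; apply: ge_ereal_sup => _ [k Sk <-].
rewrite convZ// (@le_trans _ _ (`|c|%:E * `|conv f k x|%:E)%E)//.
  by rewrite -EFinM lee_fin -normrM ler_norm.
by apply: lee_wpmul2l => //; exact: le_supconv.
Qed.

Lemma supconvZ f c (x : R) : L1 f ->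
  (supconv S (fun y => c * f y)%R x = `|c|%:E * supconv S f x)%E.
Proof.
move=> fi; apply/eqP; rewrite eq_le supconvZ_le//=.
have [->|c0] := eqVneq c 0.
  by rewrite normr0 mul0e supconv_ge0//; exact: integrable_scale.
have := supconvZ_le c^-1 x (integrable_scale c fi).
under [X in supconv S X]eq_fun do rewrite mulKf//.
have c0' : 0 < `|c| by rewrite normr_gt0.
rewrite normfV => h.
apply: le_trans (_ : (`|c|%:E *
  (`|c|^-1%:E * supconv S (fun y : R => (c * f y)%R) x) <= _)%E).
  by apply: lee_wpmul2l.
by rewrite muleA -EFinM mulfV ?mul1e// gt_eqF.
Qed.

Lemma supconv_norm_ge0 f : L1 f -> (0 <= supconv_norm S f)%E.
Proof. by move=> fi; apply: integral_ge0 => x _; exact: supconv_ge0. Qed.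

Lemma supconv_normD f g : L1 f -> L1 g ->
  (supconv_norm S (fun y => f y + g y)%R <= supconv_norm S f + supconv_norm S g)%E.
Proof.
move=> fi gi; rewrite /supconv_norm -ge0_integralD//; last 4 first.
- by move=> x _; exact: supconv_ge0.
- exact: measurable_supconv.
- by move=> x _; exact: supconv_ge0.
- exact: measurable_supconv.
apply: ge0_le_integral => //.
- by move=> x _; apply/supconv_ge0/integrable_add.
- exact: (measurable_supconv (integrable_add fi gi)).
- by apply: emeasurable_funD; exact: measurable_supconv.
- by move=> x _; exact: supconvD.
Qed.

Lemma supconv_normZ f c : L1 f ->
  (supconv_norm S (fun y => c * f y)%R = `|c|%:E * supconv_norm S f)%E.
Proof.
move=> fi; rewrite /supconv_norm -ge0_integralZl_EFin//.
- by apply: eq_integral => x _; exact: supconvZ.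
- by move=> x _; exact: supconv_ge0.
- exact: measurable_supconv.
Qed.

Lemma dilate_integrable f s : 0 < s -> L1 f -> L1 (dilate s f).
Proof.
move=> s0 fi; apply: integrable_scale.
have := @integrable_affine R s^-1 0 f _ fi.
rewrite invr_eq0 gt_eqF// => /(_ isT).
by apply: eq_integrable => // x _ /=; rewrite addr0 mulrC.
Qed.

Lemma conv_dilate f k s x : 0 < s -> L1 f -> S k ->
  conv (dilate s f) k x = s^-1 * conv f (dilate s^-1 k) (x / s).
Proof.
move=> s0 fi Sk; have s1 : s != 0 by rewrite gt_eqF.
have Sk' : S (dilate s^-1 k) by apply: kernel_dilate => //; rewrite invr_gt0.
have := @Rintegral_affine R s^-1 0 (fun y => f y * dilate s^-1 k (x / s - y)).
rewrite invr_eq0 => /(_ s1 (conv_integrable _ fi Sk')).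
rewrite /conv => h.
transitivity (s^-1 * (s^-1 *
    (`|s^-1|^-1 * \int[mu]_y (f y * dilate s^-1 k (x / s - y))))); last first.
  rewrite ger0_norm ?invr_ge0 ?ltW//; field; by rewrite s1.
rewrite -h mulrA -RintegralZl//; last first.
  have := @integrable_affine R s^-1 0 (fun y => f y * dilate s^-1 k (x / s - y)).
  by rewrite invr_eq0 => /(_ s1 (conv_integrable _ fi Sk')).
apply: eq_Rintegral => y _; rewrite /dilate !invrK addr0.
have -> : (x / s - s^-1 * y) * s = x - y by field.
by rewrite (mulrC s^-1 y); field.
Qed.

Lemma supconv_dilate f s (x : R) : 0 < s -> L1 f ->
  supconv S (dilate s f) x = (s^-1%:E * supconv S f (x / s))%E.
Proof.
move=> s0 fi; have s1 : s != 0 by rewrite gt_eqF.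
have le_dilate g t y : 0 < t -> L1 g ->
    (supconv S (dilate t g) y <= t^-1%:E * supconv S g (y / t))%E.
  move=> t0 gi; apply: ge_ereal_sup => _ [k Sk <-].
  rewrite conv_dilate// EFinM; apply: lee_wpmul2l; first by rewrite lee_fin invr_ge0 ltW.
  apply: ereal_sup_ubound; exists (dilate t^-1 k) => //.
  by apply: kernel_dilate => //; rewrite invr_gt0.
apply/eqP; rewrite eq_le le_dilate//=.
have si : 0 < s^-1 by rewrite invr_gt0.
have := le_dilate _ _ (x / s) si (dilate_integrable s0 fi).
rewrite invrK divfK//.
have -> : dilate s^-1 (dilate s f) = f.
  by apply/funext => y; rewrite /dilate invrK mulrA mulfV// mul1r mulfK.
move=> h; apply: le_trans (_ : (s^-1%:E * (s%:E * supconv S (dilate s f) x) <= _)%E).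
  by apply: lee_wpmul2l => //; rewrite lee_fin ltW.
by rewrite muleA -EFinM mulVf// mul1e.
Qed.

(** Dilating [f] amounts to dilating the kernels the other way, which leaves the
    family unchanged; this is why the norm is invariant. *)
Lemma supconv_norm_dilate f s : 0 < s -> L1 f ->
  supconv_norm S (dilate s f) = supconv_norm S f.
Proof.
move=> s0 fi; rewrite /supconv_norm.
under eq_integral do rewrite supconv_dilate//.
rewrite ge0_integralZl_EFin//; last 3 first.
- by move=> x _; exact: supconv_ge0.
- have := measurableT_comp (measurable_supconv fi) (measurable_affine s^-1 0).
  by apply: eq_measurable_fun => x _ /=; rewrite addr0 mulrC.
- by rewrite invr_ge0 ltW.
have s1 : s^-1 != 0 by rewrite invr_eq0 gt_eqF.
have := ge0_integral_affine 0 s1 (measurable_supconv fi) (fun x => supconv_ge0 x fi).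
have -> : `|s^-1|^-1 = s by rewrite gtr0_norm ?invr_gt0// invrK.
move=> affine.
have -> : (\int[mu]_x supconv S f (x / s) = s%:E * \int[mu]_x supconv S f x)%E.
  by rewrite -affine; apply: eq_integral => x _; rewrite addr0 mulrC.
by rewrite muleA -EFinM mulVf ?mul1e// gt_eqF.
Qed.

End kernel_family.
End maximal_functions.

(** * Odd functions and bounded functions of compact support *)

Section atoms.
Context (R : realType).
Local Notation mu := (@lebesgue_measure R).
Local Notation L1 f := (mu.-integrable setT (EFin \o f)).
Implicit Types (f g k : R -> R).

Lemma integrable_oneDsqrV : L1 (fun x : R => (oneDsqr x)^-1).
Proof.
have mo : measurable_fun setT (fun x : R => (oneDsqr x)^-1).
  by apply: continuous_measurable_fun; exact: continuous_oneDsqrV.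
apply/integrableP; split; first exact/measurable_EFinP.
have pos (x : R) : 0 <= (oneDsqr x)^-1.
  by rewrite invr_ge0 (le_trans ler01)// oneDsqr_ge1.
under eq_integral do rewrite /= ger0_norm//.
rewrite ge0_symfun_integralT//; last 2 first.
- exact: continuous_oneDsqrV.
- by move=> x /=; rewrite /oneDsqr sqrrN.
have := @integral0y_oneDsqr R; rewrite set_itvcy => ->.
by rewrite -EFinM ltry.
Qed.

Lemma integrable_bounded_support f B L : measurable_fun setT f ->
  (forall x, `|f x| <= B) -> (forall x, L < `|x| -> f x = 0) -> L1 f.
Proof.
move=> mf fB fL.
have B0 : 0 <= B by apply: le_trans (fB 0).
have ii : L1 (fun x : R => B * \1_(`[-L, L]%classic) x).
  by apply: integrable_scale; exact: integrable_indic_itv.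
apply: integrable_dominated ii => // x.
have [xL|xL] := leP `|x| L; last by rewrite fL// normr0 mulr_ge0.
by rewrite indicE mem_set ?mulr1//= in_itv/= -ler_norml.
Qed.

Lemma Rintegral_odd f : L1 f -> (forall x, f (- x) = - f x) -> \int[mu]_x f x = 0.
Proof.
move=> fi fodd; have := @Rintegral_affine R (-1) 0 f; rewrite oppr_eq0 oner_eq0.
move=> /(_ isT fi); rewrite normrN1 invr1 mul1r => h.
have : \int[mu]_x f x = - \int[mu]_x f x.
  rewrite -[LHS]h -[RHS]mulN1r -RintegralZl//.
  by apply: eq_Rintegral => x _; rewrite addr0 !mulN1r fodd.
by move/eqP; rewrite -subr_eq0 opprK -mulr2n mulrn_eq0/= => /eqP.
Qed.

Variables (S : set (R -> R)) (HS : kernel_family S).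

(** Near the support, the maximal function is bounded by the sup norm of [f]
    times the bound on the L1 norms of the kernels.  Far from it, the mean value
    zero allows replacing [k (x - y)] by [k (x - y) - k x], which yields a decay
    like [x^-2].  Both regimes are dominated by a multiple of
    [1 / (1 + x ^+ 2)]. *)
Lemma supconv_norm_atom f B L : measurable_fun setT f -> (forall x, `|f x| <= B) ->
  0 < L -> (forall x, L < `|x| -> f x = 0) -> \int[mu]_x f x = 0 ->
  (supconv_norm S f < +oo)%E.
Proof.
move=> mf fB L0 fL f0.
have fi := integrable_bounded_support mf fB fL.
have B0 : 0 <= B by apply: le_trans (fB 0).
have [P HP] := kernel_L1 HS.
have [C HC] := kernel_smooth HS.
pose I := \int[mu]_x `|f x|.
have I0 : 0 <= I by apply: Rintegral_ge0.
have P0 : 0 <= P.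
  have [k Sk _] := kernel_mass HS; have [_] := HP _ Sk.
  by apply: le_trans; apply: Rintegral_ge0.
pose A := B * P * (1 + 4 * L ^+ 2) + `|C| * L * I * (1 + (4 * L ^+ 2)^-1).
suff bound x : (supconv S f x <= (A * (oneDsqr x)^-1)%:E)%E.
  have Ai : L1 (fun x : R => A * (oneDsqr x)^-1).
    exact: integrable_scale integrable_oneDsqrV.
  have := integrable_lty measurableT Ai.
  apply: le_lt_trans; apply: ge0_le_integral => //.
  - by move=> x _; exact: supconv_ge0.
  - exact: measurable_supconv.
  - exact: measurable_int Ai.
have o0 : 0 < oneDsqr x by rewrite (lt_le_trans ltr01)// oneDsqr_ge1.
have T1 : 0 <= B * P * (1 + 4 * L ^+ 2).
  by rewrite !mulr_ge0// addr_ge0// mulr_ge0// sqr_ge0.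
have T2 : 0 <= `|C| * L * I * (1 + (4 * L ^+ 2)^-1).
  by rewrite !mulr_ge0// ?(ltW L0)// addr_ge0// invr_ge0 mulr_ge0// sqr_ge0.
apply: ge_ereal_sup => _ [k Sk <-]; rewrite lee_fin ler_pdivlMr//.
have ki : L1 (fun y => k (x - y)).
  have := @integrable_affine R (-1) x k; rewrite oppr_eq0 oner_eq0.
  move=> /(_ isT (HP _ Sk).1); apply: eq_integrable => // y _ /=.
  by rewrite mulN1r addrC.
have [xL|xL] := ltP `|x| (2 * L).
- apply: (@le_trans _ _ (B * P * oneDsqr x)).
    rewrite ler_wpM2r ?(ltW o0)//.
    apply: (le_trans (ler_norm _)).
    apply: (le_trans (le_normr_Rintegral _ (conv_integrable HS x fi Sk))) => //.
    apply: (@le_trans _ _ (\int[mu]_y (B * `|k (x - y)|))).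
      apply: le_Rintegral => //.
      + exact: integrable_norm (conv_integrable HS x fi Sk).
      + exact: (integrable_scale _ (integrable_norm ki)).
      + by move=> y _; rewrite normrM ler_wpM2r.
    rewrite RintegralZl//; last exact: integrable_norm ki.
    rewrite ler_wpM2l//.
    have := @Rintegral_affine R (-1) x (fun y => `|k y|); rewrite oppr_eq0 oner_eq0.
    move=> /(_ isT (integrable_norm (HP _ Sk).1)).
    rewrite normrN1 invr1 mul1r => h.
    apply: le_trans (HP _ Sk).2; rewrite -h le_eqVlt; apply/orP; left; apply/eqP.
    by apply: eq_Rintegral => y _; rewrite mulN1r addrC.
  apply: le_trans (_ : B * P * (1 + 4 * L ^+ 2) <= _); last by rewrite lerDl.
  rewrite ler_wpM2l ?mulr_ge0// /oneDsqr lerD2l -real_normK ?num_real//.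
  rewrite (_ : 4 * L ^+ 2 = (2 * L) ^+ 2); last by ring.
  by rewrite ler_sqr ?nnegrE ?normr_ge0 ?mulr_ge0 // ?ltW.
- have x0 : 0 < `|x| by rewrite (lt_le_trans _ xL)// mulr_gt0.
  have x2 : 0 < x ^+ 2 by rewrite -real_normK ?num_real// exprn_gt0.
  apply: (@le_trans _ _ (`|C| * L * I / x ^+ 2 * oneDsqr x)).
    rewrite ler_wpM2r ?(ltW o0)//.
    have -> : conv f k x = \int[mu]_y (f y * (k (x - y) - k x)).
      transitivity (\int[mu]_y (f y * k (x - y)) - \int[mu]_y (f y * k x)).
        by rewrite [X in _ - X]RintegralZr// f0 mul0r subr0.
      rewrite -RintegralB//.
      + by apply: eq_Rintegral => y _; rewrite mulrBr.
      + exact: (conv_integrable HS x fi Sk).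
      + move: (integrable_scale (k x) fi).
        by apply: eq_integrable => // y _ /=; rewrite mulrC.
    have di : L1 (fun y => f y * (k (x - y) - k x)).
      have := integrable_add (conv_integrable HS x fi Sk) (integrable_scale (- k x) fi).
      by apply: eq_integrable => // y _ /=; congr _%:E; ring.
    apply: (le_trans (ler_norm _)).
    apply: (le_trans (le_normr_Rintegral _ di)) => //.
    rewrite (_ : _ / _ = \int[mu]_y ((`|C| * L / x ^+ 2) * `|f y|)); last first.
      by rewrite RintegralZl//; [rewrite /I; ring|exact: integrable_norm fi].
    apply: le_Rintegral => //.
    + exact: integrable_norm di.
    + exact: (integrable_scale _ (integrable_norm fi)).
    + move=> y _; rewrite normrM mulrC.
      have [yL|yL] := leP `|y| L; last by rewrite fL// normr0 !mulr0.
      rewrite ler_wpM2r//.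
      apply: (le_trans (HC k x y Sk _)).
        by rewrite (le_trans _ xL)// ler_wpM2l.
      rewrite ler_wpM2r ?invr_ge0 ?(ltW x2)//.
      apply: (@le_trans _ _ (`|C| * `|y|)); first by rewrite ler_wpM2r// ler_norm.
      by rewrite ler_wpM2l.
  apply: le_trans (_ : `|C| * L * I * (1 + (4 * L ^+ 2)^-1) <= _); last by rewrite lerDr.
  rewrite -mulrA ler_wpM2l ?mulr_ge0// ?(ltW L0)//.
  rewrite /oneDsqr mulrDr mulr1 mulVf ?gt_eqF// addrC lerD2l lef_pV2 ?posrE//.
    rewrite -[leRHS]real_normK ?num_real// (_ : 4 * L ^+ 2 = (2 * L) ^+ 2); last by ring.
    by rewrite ler_sqr ?nnegrE ?normr_ge0 ?mulr_ge0 // ?ltW.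
  by rewrite mulr_gt0// exprn_gt0.
Qed.

End atoms.

(** * The maximal function dominates the function *)

Section approximate_identity.
Context (R : realType).
Local Notation mu := (@lebesgue_measure R).
Local Notation L1 f := (mu.-integrable setT (EFin \o f)).
Implicit Types (f g k : R -> R).
Variables (S : set (R -> R)) (HS : kernel_family S).

Lemma conv_dilate_kernel f k s x : 0 < s -> L1 f -> S k ->
  conv f (dilate s k) x = \int[mu]_u (f (x - s * u) * k u).
Proof.
move=> s0 fi Sk; have s1 : s != 0 by rewrite gt_eqF.
pose g y := f y * k ((x - y) / s).
have gi : L1 g.
  have Sk' : S (dilate s k) by exact: kernel_dilate.
  have := integrable_scale s (conv_integrable HS x fi Sk').
  by apply: eq_integrable => // y _ /=; rewrite /dilate /g; congr _%:E; field.
have := @Rintegral_affine R (- s) x g; rewrite oppr_eq0 => /(_ s1 gi).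
rewrite normrN gtr0_norm// => h.
transitivity (s^-1 * \int[mu]_y g y).
  rewrite /conv -RintegralZl//.
  by apply: eq_Rintegral => y _; rewrite /g /dilate; ring.
rewrite -h; apply: eq_Rintegral => u _; rewrite /g.
have -> : x - (- s * u + x) = s * u by ring.
have -> : s * u / s = u by field.
by congr (f _ * _); ring.
Qed.

(** The dilates of [k] are an approximate identity of mass [int k]: along
    [s = 1 / (n + 1)], the convolutions converge to [f x * int k] by dominated
    convergence, and all of them lie below the supremum. *)
Lemma supconv_ge_at_continuity f (B : R) k (x : R) : L1 f -> (forall y, `|f y| <= B) ->
  {for x, continuous f} -> S k ->
  (`|f x * \int[mu]_u k u|%:E <= supconv S f x)%E.
Proof.
move=> fi fB fx Sk.
have [P HP] := kernel_L1 HS; have ki := (HP _ Sk).1.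
have mf := integrable_measurable fi.
pose s (n : nat) : R := n.+1%:R^-1.
have s0 n : 0 < s n by rewrite invr_gt0.
pose h n u := f (x - s n * u) * k u.
have mh n : measurable_fun setT (h n).
  apply: measurable_funM; last exact: kernel_measurable HS _ Sk.
  apply: (measurableT_comp mf).
  by apply: measurable_funB => //; apply: measurable_funM.
have di : L1 (fun u => B * `|k u|) := integrable_scale B (integrable_norm ki).
have hB n u : `|h n u| <= B * `|k u| by rewrite normrM ler_wpM2r.
have hi n : L1 (h n) by apply: integrable_dominated di.
have hf u : (h n u)%:E @[n --> \oo] --> (f x * k u)%:E.
  apply/fine_cvgP; split => /=; first exact: nearW.
  apply: cvgMr_tmp.
  have xs : x - s n * u @[n --> \oo] --> x - 0 * u.
    apply: cvgB; first exact: cvg_cst.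
    apply: cvgMr_tmp; exact: cvg_harmonic.
  rewrite mul0r subr0 in xs.
  exact: (cvg_comp (fun n => x - s n * u) f xs fx).
have cv : (\int[mu]_u (h n u)%:E @[n --> \oo] --> \int[mu]_u (f x * k u)%:E)%E.
  have [//|||||_ _ //] := @dominated_convergence _ _ _ mu setT measurableT
    (fun n u => (h n u)%:E) (fun u => (f x * k u)%:E) (fun u => (B * `|k u|)%:E).
  - by move=> n; exact: measurable_int (hi n).
  - exact: measurable_int (integrable_scale (f x) ki).
  - by apply: aeW => u _; exact: hf.
  - exact: di.
  - by apply: aeW => u n _; rewrite lee_fin.
have fk : `|f x * \int[mu]_u k u|%:E = (`|\int[mu]_u (f x * k u)%:E|)%E.
  rewrite -EFin_normr_Rintegral//; last exact: integrable_scale.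
  by rewrite RintegralZl.
rewrite fk; apply: cvge_to_le (cvg_abse cv) _; apply: nearW => n /=.
have := le_supconv HS x fi (kernel_dilate HS Sk (s0 n)); apply: le_trans.
by rewrite -EFin_normr_Rintegral// conv_dilate_kernel.
Qed.

End approximate_identity.

(** * Truncations of the inverse function *)

Section truncated_inverse.
Context (R : realType).
Local Notation mu := (@lebesgue_measure R).
Local Notation L1 f := (mu.-integrable setT (EFin \o f)).
Implicit Types (f g k : R -> R).

Lemma measurable_inv : measurable_fun setT (fun x : R => x^-1).
Proof.
rewrite -(setUv [set (0 : R)]); apply/measurable_funU => //; first exact: measurableC.
split; first exact: measurable_fun_set1.
apply: open_continuous_measurable_fun.
  by apply: closed_openC; exact: closed_eq.
move=> x; rewrite inE /= => /eqP x0; exact: inv_continuous.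
Qed.

(** The almost fixed vectors of the dilations: with [u x = 1 / x] for
    [1 <= |x|], [truncinv N] is [u - dilate N u]. *)
Definition truncinv (N x : R) : R := \1_[set y : R | 1 <= `|y| < N] x / x.

Lemma truncinvE N x : truncinv N x = if 1 <= `|x| < N then x^-1 else 0.
Proof.
rewrite /truncinv indicE; case: ifPn => h; first by rewrite mem_set// mul1r.
by rewrite memNset ?mul0r//; exact/negP.
Qed.

Lemma measurable_truncinv N : measurable_fun setT (truncinv N).
Proof.
apply: measurable_funM; last exact: measurable_inv.
apply: measurable_indic.
rewrite (_ : [set _ | _] = @Num.norm _ R @^-1` `[1, N[%classic).
  by rewrite -[X in measurable X]setTI; exact: normr_measurable.
by apply/seteqP; split => y /=; rewrite in_itv.
Qed.

Lemma truncinv_le1 N x : `|truncinv N x| <= 1.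
Proof.
rewrite truncinvE; case: ifPn => [/andP[x1 _]|_]; last by rewrite normr0.
by rewrite normfV invf_le1// (lt_le_trans _ x1).
Qed.

Lemma truncinv_support N x : N < `|x| -> truncinv N x = 0.
Proof. by move=> xN; rewrite truncinvE ltNge (ltW xN) andbF. Qed.

Lemma truncinv_odd N x : truncinv N (- x) = - truncinv N x.
Proof. by rewrite !truncinvE normrN; case: ifP; rewrite ?oppr0 ?invrN. Qed.

Lemma integrable_truncinv N : L1 (truncinv N).
Proof.
apply: integrable_bounded_support (@truncinv_le1 N) (@truncinv_support N).
exact: measurable_truncinv.
Qed.

Variables (S : set (R -> R)) (HS : kernel_family S).

Lemma supconv_norm_truncinv_lty N : 0 < N -> (supconv_norm S (truncinv N) < +oo)%E.
Proof.
move=> N0; apply: (supconv_norm_atom HS (measurable_truncinv N)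
  (@truncinv_le1 N) N0 (@truncinv_support N)).
apply: Rintegral_odd; [exact: integrable_truncinv|exact: truncinv_odd].
Qed.

Lemma integral_inv (N : R) : 1 < N -> (\int[mu]_(x in `[1%R, N]) (x^-1)%:E = (ln N)%:E)%E.
Proof.
move=> N1; rewrite (@continuous_FTC2 _ _ (@ln R) 1 N) ?ln1 ?sube0//.
- apply: continuous_in_subspaceT => x; rewrite inE/= in_itv/= => /andP[x1 _].
  by apply: inv_continuous; rewrite gt_eqF// (lt_le_trans _ x1).
- split.
  + move=> x; rewrite in_itv/= => /andP[x1 _]; apply: ex_derive.
    by apply: is_derive1_ln; rewrite (lt_trans _ x1).
  + by apply: cvg_at_right_filter; exact: continuous_ln.
  + by apply: cvg_at_left_filter; apply: continuous_ln; rewrite (lt_trans _ N1).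
- move=> x; rewrite in_itv/= => /andP[x1 _].
  by rewrite derive1E; apply: derive_val; apply: is_derive1_ln; rewrite (lt_trans _ x1).
Qed.

(** The maximal function is at least [(int k) / x] on the interval from [1] to
    [N], by continuity of [truncinv N] there. *)
Lemma supconv_norm_truncinv_ge : exists2 c : R, 0 < c &
  forall N, 1 < N -> ((c * ln N)%:E <= supconv_norm S (truncinv N))%E.
Proof.
have [k Sk k0] := kernel_mass HS; exists (\int[mu]_u k u) => // N N1.
have ci := integrable_truncinv N.
rewrite EFinM -integral_inv// -ge0_integralZl//; last 3 first.
- by apply/measurable_EFinP/measurable_funTS; exact: measurable_inv.
- move=> x /=; rewrite in_itv/= => /andP[x1 _].
  by rewrite lee_fin invr_ge0 (le_trans _ x1).
- by rewrite lee_fin ltW.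
have mE : measurable_fun `]1, N[ (fun x : R => ((\int[mu]_u k u)%:E * x^-1%:E)%E).
  apply/measurable_EFinP/measurable_funTS; apply: measurable_funM => //.
  exact: measurable_inv.
rewrite (@integral_itv_bndoo _ _ _ _ true false)//.
apply: (@le_trans _ _ (\int[mu]_(x in `]1%R, N[) supconv S (truncinv N) x)%E).
  apply: ge0_le_integral => //.
  - move=> x /=; rewrite in_itv/= => /andP[x1 _].
    by rewrite -EFinM lee_fin mulr_ge0 ?invr_ge0 ?ltW// (lt_trans _ x1).
  - by apply: measurable_funTS; exact: measurable_supconv.
  - move=> x /=; rewrite in_itv/= => /andP[x1 xN].
    have x0 : 0 < x by rewrite (lt_trans _ x1).
    have cx : truncinv N x = x^-1 by rewrite truncinvE gtr0_norm// (ltW x1) xN.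
    have := @supconv_ge_at_continuity R S HS (truncinv N) 1 k x ci (@truncinv_le1 N).
    rewrite cx normrM normfV !gtr0_norm// -EFinM mulrC; apply => //.
    rewrite /prop_for /continuous_at cx.
    apply: cvg_trans (inv_continuous (lt0r_neq0 x0)); apply: near_eq_cvg.
    near=> y; have y1 : 1 < y by near: y; exact: (cvgr_gt x cvg_id).
    rewrite truncinvE gtr0_norm ?(lt_trans _ y1)// (ltW y1)/= ifT//.
    by near: y; apply: lt_nbhsl.
apply: ge0_subset_integral => //.
- exact: measurable_supconv.
- by move=> x _; exact: supconv_ge0.
Unshelve. all: by end_near. Qed.

End truncated_inverse.

(** * The Hausdorff operator on real functions and the inequality of Minkowski *)

Section real_hausdorff.
Context (R : realType).
Local Notation mu := (@lebesgue_measure R).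
Local Notation L1 f := (mu.-integrable setT (EFin \o f)).
Implicit Types (f g k psi : R -> R).

(** Meant for densities [psi] on the whole line that vanish on the negative
    half-line, so that all integrals have the same domain. *)
Definition rhausdorff psi f (x : R) : R := \int[mu]_t (f (x / t) * (psi t / t)).

Lemma measurable_quotient d (T : measurableType d) (a b : T -> R) :
  measurable_fun setT a -> measurable_fun setT b ->
  measurable_fun setT (fun z => a z / b z).
Proof.
move=> ma mb; apply: measurable_funM => //.
exact: (measurableT_comp (@measurable_inv R) mb).
Qed.

Section minkowski.
Variables (psi f : R -> R).
Hypotheses (psi_ge0 : forall t, 0 <= psi t) (psi_le0 : forall t, t <= 0 -> psi t = 0).
Hypotheses (psi_L1 : L1 psi) (f_L1 : L1 f).

Let F (p : measurableTypeR R * measurableTypeR R) : R := f (p.1 / p.2) * (psi p.2 / p.2).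

Let mF : measurable_fun setT F.
Proof.
apply: measurable_funM.
  apply: (measurableT_comp (integrable_measurable f_L1)).
  exact: measurable_quotient measurable_fst measurable_snd.
apply: measurable_quotient; last exact: measurable_snd.
exact: (measurableT_comp (integrable_measurable psi_L1) measurable_snd).
Qed.

Let integral_dilate_abs t : 0 < t ->
  (\int[mu]_x (`|f (x / t)|)%:E = t%:E * \int[mu]_x (`|f x|)%:E)%E.
Proof.
move=> t0; have := @ge0_integral_affine R t^-1 0 (fun x => (`|f x|)%:E).
rewrite invr_eq0 gt_eqF// => /(_ isT) h.
rewrite ger0_norm ?invr_ge0 ?ltW// invrK in h.
rewrite -h//; last first.
  by apply/measurable_EFinP/measurableT_comp => //; exact: integrable_measurable.
by apply: eq_integral => x _; rewrite addr0 mulrC.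
Qed.

(* Tonelli: the inner integral in [x] is [psi t] times the L1 norm of [f]. *)
Let F_integrable : (mu \x mu)%E.-integrable setT (EFin \o F).
Proof.
apply/integrable21ltyP; first exact/measurable_EFinP.
rewrite (_ : (\int[mu]_t _)%E =
  (\int[mu]_t ((psi t)%:E * \int[mu]_x (`|f x|)%:E))%E); last first.
  apply: eq_integral => t _ /=.
  have [t0|t0] := ltP 0 t; last first.
    rewrite psi_le0// mul0e integral0_eq// => x _.
    by rewrite /F /= psi_le0// mul0r mulr0 normr0.
  under eq_integral do rewrite /F /= normrM EFinM muleC.
  rewrite ge0_integralZl//; last first.
    apply/measurable_EFinP/measurableT_comp => //.
    apply: (measurableT_comp (integrable_measurable f_L1)).
    by apply: measurable_funM.
  rewrite integral_dilate_abs// muleA -EFinM ger0_norm ?divfK ?gt_eqF//.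
  by rewrite divr_ge0 ?(ltW t0).
have fl : (\int[mu]_x (`|f x|)%:E < +oo)%E by have /integrableP[_] := f_L1.
rewrite ge0_integralZr//; last 3 first.
- exact: measurable_int psi_L1.
- by move=> t _; rewrite lee_fin.
- by apply: integral_ge0.
apply: lte_mul_pinfty => //.
- by apply: integral_ge0 => t _; rewrite lee_fin.
- exact: integrable_fin_num psi_L1.
Qed.

Lemma rhausdorff_integrable : L1 (rhausdorff psi f).
Proof.
have := integrable_fubini_F F_integrable.
move=> /[dup] /measurable_int mfF; apply: le_integrable => //.
- apply/measurable_EFinP.
  exact: (measurableT_comp (fine_measurable measurableT) mfF).
- move=> x _; rewrite /rhausdorff /Rintegral /fubini_F /=.
  by case: (integral _ _ _) => [r| |] /=; rewrite ?lexx ?leey.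
Qed.

(** The inequality of Minkowski: the maximal function is sublinear, so that of
    an average of dilates is at most the average of the maximal functions, and
    each dilate has the norm of [f].  Fubini lets a convolution enter the
    average. *)
Lemma supconv_norm_rhausdorff S (HS : kernel_family S) :
  (supconv_norm S (rhausdorff psi f) <= (\int[mu]_t (psi t)%:E) * supconv_norm S f)%E.
Proof.
pose H (p : measurableTypeR R * measurableTypeR R) : \bar R :=
  ((psi p.2 / p.2)%:E * supconv S f (p.1 / p.2))%E.
have mH : measurable_fun setT H.
  apply: emeasurable_funM.
    apply/measurable_EFinP/measurable_quotient; last exact: measurable_snd.
    exact: (measurableT_comp (integrable_measurable psi_L1) measurable_snd).
  apply: (measurableT_comp (measurable_supconv HS f_L1)).
  exact: measurable_quotient measurable_fst measurable_snd.
have psit t : 0 <= psi t / t.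
  have [t0|t0] := ltP 0 t; last by rewrite psi_le0// mul0r.
  by rewrite divr_ge0// ltW.
have H0 p : (0 <= H p)%E.
  by rewrite mule_ge0// ?lee_fin//; exact: supconv_ge0.
have key x : (supconv S (rhausdorff psi f) x <=
    \int[mu]_t ((psi t / t)%:E * supconv S f (x / t)))%E.
  apply: ge_ereal_sup => _ [k Sk <-].
  have [L HL] := kernel_bounded HS Sk.
  pose G (p : measurableTypeR R * measurableTypeR R) : R := F p * k (x - p.1).
  have mG : measurable_fun setT G.
    apply: measurable_funM => //.
    apply: (measurableT_comp (kernel_measurable HS Sk)).
    by apply: measurable_funB.
  have G_integrable : (mu \x mu)%E.-integrable setT (EFin \o G).
    have := integrableZl measurableT L F_integrable.
    apply: le_integrable => //; first exact/measurable_EFinP.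
    move=> p _ /=; rewrite lee_fin /G !normrM mulrC ler_wpM2r//.
    by rewrite (le_trans (HL _))// ler_norm.
  have ki := conv_integrable HS x rhausdorff_integrable Sk.
  have -> : (conv (rhausdorff psi f) k x)%:E = (\int[mu]_y \int[mu]_t (G (y, t))%:E)%E.
    rewrite /conv fineK; last exact: integrable_fin_num ki.
    apply: ae_eq_integral => //.
    - exact: measurable_int ki.
    - exact: (measurable_int _ (integrable_fubini_F G_integrable)).
    have := ae_integrable1 F_integrable; apply: filterS => y Fy _.
    rewrite /G /= /rhausdorff /Rintegral EFinM fineK; last exact: integrable_fin_num Fy.
    rewrite muleC -integralZl//.
    by apply: eq_integral => t _; rewrite -EFinM mulrC.
  rewrite (Fubini G_integrable).
  apply: (@le_trans _ _ (\int[mu]_t `|\int[mu]_y (G (y, t))%:E|)%E).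
    apply: le_trans (lee_abs _) _; apply: le_abse_integral => //.
    exact: (measurable_fubini_G G_integrable).
  apply: ge0_le_integral => //.
  - apply: measurableT_comp => //.
    exact: (measurable_fubini_G G_integrable).
  - exact: (measurableT_comp mH (measurable_pair1 x)).
  - move=> t _.
    have [t0|t0] := ltP 0 t; last first.
      rewrite psi_le0// mul0r mul0e integral0_eq ?abse0// => y _.
      by rewrite /G /F /= psi_le0// mul0r mulr0 mul0r.
    have dfi := dilate_integrable t0 f_L1.
    have cvi := conv_integrable HS x dfi Sk.
    have -> : (\int[mu]_y (G (y, t))%:E = (psi t)%:E * (conv (dilate t f) k x)%:E)%E.
      rewrite /conv fineK; last exact: integrable_fin_num cvi.
      rewrite -integralZl//; apply: eq_integral => y _.
      by rewrite -EFinM /G /F /dilate /=; congr _%:E; ring.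
    rewrite EFinM -muleA -supconv_dilate// abseM gee0_abs ?lee_fin//.
    by apply: lee_wpmul2l; [rewrite lee_fin|exact: le_supconv].
apply: (@le_trans _ _ (\int[mu]_x \int[mu]_t H (x, t))%E).
  apply: ge0_le_integral => //.
  - by move=> x _; apply: (supconv_ge0 HS); exact: rhausdorff_integrable.
  - by apply: (measurable_supconv HS); exact: rhausdorff_integrable.
  - exact: measurable_fun_fubini_tonelli_F.
rewrite fubini_tonelli// le_eqVlt; apply/orP; left; apply/eqP.
rewrite -ge0_integralZr//; last 3 first.
- exact: measurable_int psi_L1.
- by move=> t _; rewrite lee_fin.
- exact: (supconv_norm_ge0 HS f_L1).
apply: eq_integral => t _.
have [t0|t0] := ltP 0 t; last first.
  rewrite psi_le0// mul0e integral0_eq// => x _.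
  by rewrite /H /= psi_le0// mul0r mul0e.
have Di := dilate_integrable t0 f_L1.
rewrite -(supconv_norm_dilate HS t0 f_L1) /supconv_norm -ge0_integralZl.
- by apply: eq_integral => x _; rewrite supconv_dilate// muleA -EFinM.
- by [].
- exact: measurable_supconv.
- by move=> x _; exact: (supconv_ge0 HS).
- by rewrite lee_fin.
Qed.

End minkowski.
End real_hausdorff.

(** * Integrability of the density *)

Section hausdorff_truncated_inverse.
Context (R : realType).
Local Notation mu := (@lebesgue_measure R).
Local Notation L1 f := (mu.-integrable setT (EFin \o f)).
Implicit Types (f g k psi : R -> R).

Variable psi : R -> R.
Hypotheses (psi_ge0 : forall t, 0 <= psi t) (psi_le0 : forall t, t <= 0 -> psi t = 0).

(** Dilating [1 / x] does not change it, so [t] only moves the window where the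
    truncation is active; hence [psi t] survives without any weight. *)
Lemma truncinv_integrand N x t : 0 < N ->
  truncinv N (x / t) * (psi t / t) =
  x^-1 * (psi t * \1_(`]`|x| / N, `|x|]%classic) t).
Proof.
move=> N0; have [t0|t0] := ltP 0 t; last by rewrite psi_le0// !(mul0r, mulr0).
rewrite truncinvE indicE normrM normfV (gtr0_norm t0) ler_pdivlMr// mul1r.
rewrite ltr_pdivrMr// mulrC.
have -> : (t \in (`]`|x| / N, `|x|]%classic : set R)) = (t <= `|x| < N * t).
  by rewrite mem_setE in_itv/= ltr_pdivrMr// andbC (mulrC t).
case: ifP => _; last by rewrite !mulr0.
by rewrite invfM invrK mulr1; set y := x^-1; field; rewrite gt_eqF.
Qed.

Section finiteness.
Hypothesis psi_meas : measurable_fun setT psi.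
Hypothesis psi_loc : forall a b, 0 < a -> (\int[mu]_(t in `[a, b]) (psi t)%:E < +oo)%E.

(** For [0 < x] the image of [truncinv 2] is [x^-1] times the integral of [psi]
    over the interval from [x / 2] to [x].  Exchanging the integrals weights
    [psi t] with the integral of [1 / x] for [t <= x < 2 t], which is at least
    [1 / 2]. *)
Lemma integrable_of_rhausdorff : L1 (rhausdorff psi (truncinv 2)) -> L1 psi.
Proof.
move=> hi.
pose F (p : measurableTypeR R * measurableTypeR R) : R :=
  \1_(`]0, +oo[%classic) p.1 * (truncinv 2 (p.1 / p.2) * (psi p.2 / p.2)).
have mF : measurable_fun setT F.
  apply: measurable_funM.
    by apply: (measurableT_comp (measurable_indic _) measurable_fst).
  apply: measurable_funM.
    apply: (measurableT_comp (measurable_truncinv _)).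
    exact: measurable_quotient measurable_fst measurable_snd.
  apply: measurable_quotient; last exact: measurable_snd.
  exact: (measurableT_comp psi_meas measurable_snd).
have F0 p : 0 <= F p.
  rewrite /F truncinv_integrand// indicE mem_setE in_itv/= andbT.
  have [x0|x0] := ltP 0 p.1; last by rewrite mul0r.
  by rewrite mul1r !mulr_ge0// invr_ge0 ltW.
have Fx : (\int[mu]_x \int[mu]_t (F (x, t))%:E < +oo)%E.
  have := integrable_lty measurableT (integrable_norm hi); apply: le_lt_trans.
  apply: ge0_le_integral => //.
  - by move=> x _; apply: integral_ge0 => t _; rewrite lee_fin.
  - by apply: (measurable_fun_fubini_tonelli_F (EFin \o F)) => //;
      exact/measurable_EFinP.
  - exact: measurable_int (integrable_norm hi).
  move=> x _.
  have [x0|x0] := ltP 0 x; last first.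
    rewrite integral0_eq ?lee_fin ?normr_ge0 //= => t _.
    by rewrite /F /= indicE mem_setE in_itv/= andbT ltNge x0 mul0r.
  have ix : L1 (fun t => truncinv 2 (x / t) * (psi t / t)).
    under eq_fun do rewrite /= truncinv_integrand//.
    apply: integrable_scale; apply/integrableP; split.
      by apply/measurable_EFinP/measurable_funM => //; exact: measurable_indic.
    have := @psi_loc (x / 2) x; rewrite divr_gt0// => /(_ isT).
    apply: le_lt_trans; rewrite [leRHS]integral_mkcond.
    apply: ge0_le_integral => //.
    - apply: measurableT_comp => //.
      by apply/measurable_EFinP/measurable_funM => //; exact: measurable_indic.
    - apply/(measurable_restrictT _ _).1 => //.
      exact/measurable_EFinP/measurable_funTS.
    - move=> t _; rewrite patchE /= ger0_norm ?mulr_ge0// indicE !mem_setE !in_itv/=.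
      rewrite gtr0_norm//; case: ifP => [_|].
        by rewrite lee_fin ler_piMr// lern1 leq_b1.
      by case: (ltP (x / 2) t) => [/ltW -> /= -> |_ _]; rewrite mulr0.
  rewrite (_ : (\int[mu]_t _)%E = (rhausdorff psi (truncinv 2) x)%:E).
    by rewrite lee_fin ler_norm.
  rewrite /rhausdorff /Rintegral fineK; last exact: integrable_fin_num ix.
  by apply: eq_integral => t _; rewrite /F /= indicE mem_setE in_itv/= x0 mul1r.
rewrite (fubini_tonelli (EFin \o F)) in Fx; last 2 first.
- exact/measurable_EFinP.
- by move=> z; rewrite lee_fin.
have half : L1 (fun t => 2^-1 * psi t).
  apply/integrableP; split; first by apply/measurable_EFinP/measurable_funM.
  apply: le_lt_trans Fx; apply: ge0_le_integral => //.
  - by apply/measurable_EFinP/measurableT_comp => //; exact: measurable_funM.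
  - by apply: (measurable_fun_fubini_tonelli_G (EFin \o F)) => //;
      exact/measurable_EFinP.
  move=> t _ /=; rewrite ger0_norm ?mulr_ge0//.
  have [t0|t0] := ltP 0 t; last first.
    by rewrite psi_le0// mulr0 integral_ge0// => x _; rewrite lee_fin.
  have -> : ((2^-1 * psi t)%:E =
    \int[mu]_x (psi t / (2 * t) * \1_(`[t, 2 * t[%classic) x)%:E)%E.
    under eq_integral do rewrite EFinM.
    rewrite ge0_integralZl//; last 2 first.
    - by apply/measurable_EFinP; exact: measurable_indic.
    - by rewrite lee_fin divr_ge0// mulr_ge0// ltW.
    rewrite integral_indic// setIT [X in (_ * X)%E]lebesgue_measure_itv/=.
    rewrite lte_fin ltr_pMl// ltr1n.
    by rewrite -EFinD -EFinM; congr _%:E; field; rewrite gt_eqF.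
  apply: ge0_le_integral => //.
  - by move=> x _; rewrite lee_fin mulr_ge0// divr_ge0// mulr_ge0// ltW.
  - by apply/measurable_EFinP/measurable_funM => //; exact: measurable_indic.
  - by apply/measurable_EFinP; exact: (measurableT_comp mF (measurable_pair2 t)).
  move=> x _; rewrite lee_fin.
  rewrite indicE mem_setE in_itv/=.
  case: (boolP ((t <= x) && _)) => [/andP[tx xt]|_]; last by rewrite mulr0.
  have x0 : 0 < x by rewrite (lt_le_trans t0).
  rewrite /F /= indicE mem_setE in_itv/= x0/= mul1r mulr1 truncinv_integrand//.
  have xt2 : x / 2 < t by rewrite ltr_pdivrMr// mulrC.
  rewrite indicE mem_setE in_itv/= gtr0_norm// xt2 tx mulr1 [leRHS]mulrC.
  by rewrite ler_wpM2l// lef_pV2 ?posrE ?mulr_gt0// ltW.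
have := integrable_scale 2 half; apply: eq_integrable => // t _ /=.
by congr _%:E; field.
Qed.

End finiteness.

End hausdorff_truncated_inverse.

(** * Lower bound for the norm *)

Section norm_comparison.
Context (R : realType).
Local Notation mu := (@lebesgue_measure R).
Local Notation L1 f := (mu.-integrable setT (EFin \o f)).
Implicit Types (f g k psi : R -> R).

Lemma rhausdorff_truncinv_integrand psi N x : 0 < N -> L1 psi ->
  (forall t, t <= 0 -> psi t = 0) -> L1 (fun t => truncinv N (x / t) * (psi t / t)).
Proof.
move=> N0 psi_L1 psi_le0; under eq_fun do rewrite /= truncinv_integrand//.
apply: integrable_scale; apply: (@integrable_bounded_mul _ _ _ 1) => // t.
by rewrite indicE ger0_norm// lern1 leq_b1.
Qed.

Section cutoff.
Variables (psi : R -> R) (K : R).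
Hypotheses (psi_ge0 : forall t, 0 <= psi t) (psi_L1 : L1 psi).
Hypotheses (K1 : 1 < K) (psi_supp : forall t, ~~ (K^-1 <= t <= K) -> psi t = 0).

Let K0 : 0 < K. Proof. by rewrite (lt_trans _ K1). Qed.

Let psi_le0 t : t <= 0 -> psi t = 0.
Proof.
by move=> t0; rewrite psi_supp// negb_and -ltNge (le_lt_trans t0)// invr_gt0.
Qed.

Let psi_indic_L1 (A : set R) : measurable A -> L1 (fun t => psi t * \1_A t).
Proof.
move=> mA; apply: (@integrable_bounded_mul _ _ _ 1) => // t.
by rewrite indicE ger0_norm// lern1 leq_b1.
Qed.

Let I : R := \int[mu]_t psi t.

Let A (r : R) : R := \int[mu]_t (psi t * \1_(`]-oo, r]%classic) t).

Let A_mono : {homo A : r s / r <= s}.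
Proof.
move=> r s rs; apply: le_Rintegral => //; [exact: psi_indic_L1..|].
move=> t _; rewrite ler_wpM2l// !indicE ler_nat !mem_setE !in_itv/=.
by have [tr|] := leP t r; rewrite ?(le_trans tr rs).
Qed.

Let A_small r : r < K^-1 -> A r = 0.
Proof.
move=> rK; rewrite /A; under eq_Rintegral => t _.
  rewrite indicE mem_setE in_itv/=.
  rewrite (_ : psi t * _ = 0); first over.
  have [tr|] := leP t r; last by rewrite mulr0.
  by rewrite psi_supp ?mul0r// negb_and -ltNge (le_lt_trans tr rK).
by rewrite Rintegral_cst// mul0r.
Qed.

Let A_large r : K <= r -> A r = I.
Proof.
move=> rK; apply: eq_Rintegral => t _; rewrite indicE mem_setE in_itv/=.
have [tr|rt] := leP t r; first by rewrite mulr1.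
by rewrite mulr0 psi_supp// negb_and -!ltNge (le_lt_trans rK rt) orbT.
Qed.

Let A_ge0 r : 0 <= A r.
Proof. by apply: Rintegral_ge0 => t _; rewrite mulr_ge0. Qed.

Let A_le r : A r <= I.
Proof.
have [rK|Kr] := leP r K; last by rewrite A_large// ltW.
by rewrite -(A_large (lexx K)) A_mono.
Qed.

(* [G = T u - I u] where [u x = 1 / x] for [1 <= |x|]: the integral of [psi]
   over [t <= |x|] is [x] times [T u x]. *)
Let G (x : R) : R := x^-1 * (A `|x| - I * (1 <= `|x|)%R%:R).

Let measurable_G : measurable_fun setT G.
Proof.
apply: measurable_funM; first exact: measurable_inv.
apply: measurable_funB.
  apply: (@measurableT_comp _ _ _ _ _ _ A); last exact: normr_measurable.
  exact: nondecreasing_measurable.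
apply: measurable_funM => //.
rewrite (_ : (fun x : R => _) = \1_(@Num.norm _ R @^-1` `[1, +oo[%classic)).
  apply: measurable_indic; rewrite -[X in measurable X]setTI.
  exact: normr_measurable.
apply/funext => x; rewrite indicE; congr (nat_of_bool _)%:R.
by apply/idP/idP; rewrite inE/= in_itv/= andbT.
Qed.

Let G_small x : `|x| < K^-1 -> G x = 0.
Proof.
move=> xK; rewrite /G A_small// leNgt (lt_le_trans xK) ?invf_le1// ?(ltW K1)//.
by rewrite mulr0 subrr mulr0.
Qed.

Let G_support x : K < `|x| -> G x = 0.
Proof.
move=> xK; rewrite /G A_large ?(ltW xK)// (ltW (lt_trans K1 xK)).
by rewrite mulr1 subrr mulr0.
Qed.

Let G_bounded x : `|G x| <= K * I.
Proof.
have I0 : 0 <= I by rewrite (le_trans (A_ge0 0)).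
have [xK|xK] := ltP `|x| K^-1; first by rewrite G_small// normr0 mulr_ge0// ltW.
rewrite normrM ler_pM//.
  rewrite normfV -[leRHS]invrK lef_pV2// posrE ?invr_gt0//.
  by rewrite (lt_le_trans _ xK)// invr_gt0.
have := A_ge0 `|x|; have := A_le `|x|; case: (1 <= `|x|)%R.
  by rewrite mulr1 ler_norml => *; apply/andP; split; lra.
by rewrite mulr0 subr0 => ? ?; rewrite ger0_norm.
Qed.

Let G_odd x : G (- x) = - G x.
Proof. by rewrite /G normrN invrN mulNr. Qed.

Let G_L1 : L1 G.
Proof. exact: integrable_bounded_support measurable_G G_bounded G_support. Qed.

(* [truncinv N = u - dilate N u], and [T] commutes with [dilate N]. *)
Let rhausdorff_sub N x : 1 < N ->
  rhausdorff psi (truncinv N) x = I * truncinv N x + (G x - dilate N G x).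
Proof.
move=> N1; have N0 : 0 < N by rewrite (lt_trans _ N1).
have -> : rhausdorff psi (truncinv N) x = x^-1 * (A `|x| - A (`|x| / N)).
  rewrite -RintegralB//; [|exact: psi_indic_L1..].
  rewrite -RintegralZl//; last first.
    have := integrable_add (psi_indic_L1 (measurable_itv `]-oo, `|x|]))
       (integrable_scale (-1) (psi_indic_L1 (measurable_itv `]-oo, `|x| / N]))).
    by apply: eq_integrable => // t _ /=; rewrite mulN1r.
  apply: eq_Rintegral => t _; rewrite truncinv_integrand// -mulrBr.
  congr (_ * (_ * _)); rewrite !indicE !mem_setE !in_itv/=.
  have xN : `|x| / N <= `|x| by rewrite ler_pdivrMr// ler_peMr// ltW.
  have [xt|tx] := ltP (`|x| / N) t; first by rewrite subr0.
  by rewrite (le_trans tx xN) subrr.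
have -> : truncinv N x = x^-1 * ((1 <= `|x|)%R%:R - (1 <= `|x / N|)%R%:R).
  rewrite truncinvE normrM normfV (gtr0_norm N0) ler_pdivlMr// mul1r leNgt.
  have [xN|Nx] := ltP `|x| N.
    by rewrite andbT subr0; case: ltP; rewrite ?mulr1 ?mulr0.
  by rewrite andbF ltNge (le_trans (ltW N1) Nx) subrr mulr0.
rewrite /dilate /G invfM invrK !normrM !normfV (gtr0_norm N0).
set y := x^-1; set b1 := (X in X%:R); set b2 := (1 <= _ / _)%R.
by field; rewrite gt_eqF.
Qed.

Variables (S : set (R -> R)) (HS : kernel_family S).

(** The error [G - dilate N G] has norm at most twice that of [G], whatever
    [N] is. *)
Lemma supconv_norm_rhausdorff_almost_eigen : exists C : R, forall N, 1 < N ->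
  (I%:E * supconv_norm S (truncinv N) <=
   supconv_norm S (rhausdorff psi (truncinv N)) + C%:E)%E.
Proof.
have Gfin : supconv_norm S G \is a fin_num.
  rewrite ge0_fin_numE; last exact: (supconv_norm_ge0 HS G_L1).
  apply: (supconv_norm_atom HS measurable_G G_bounded K0 G_support).
  exact: Rintegral_odd G_L1 G_odd.
exists (2 * fine (supconv_norm S G)) => N N1.
have N0 : 0 < N by rewrite (lt_trans _ N1).
have ci := integrable_truncinv N.
have hi := rhausdorff_integrable psi_ge0 psi_le0 psi_L1 ci.
have I0 : 0 <= I by rewrite (le_trans (A_ge0 0)).
have Di := dilate_integrable N0 G_L1.
rewrite -{1}(ger0_norm I0) -(supconv_normZ HS)//.
have -> : (fun y => I * truncinv N y) =
  (fun y => rhausdorff psi (truncinv N) y + (dilate N G y + (-1) * G y)).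
  by apply/funext => y; rewrite rhausdorff_sub//; ring.
apply: (le_trans (supconv_normD HS hi (integrable_add Di (integrable_scale _ G_L1)))).
rewrite leeD2l//.
apply: (le_trans (supconv_normD HS Di (integrable_scale _ G_L1))).
rewrite (supconv_norm_dilate HS)// (supconv_normZ HS)// normrN1 mul1e EFinM fineK//.
by rewrite mule_natl mule2n.
Qed.

End cutoff.

Variables (S : set (R -> R)) (HS : kernel_family S).
Variable psi : R -> R.
Hypotheses (psi_ge0 : forall t, 0 <= psi t) (psi_le0 : forall t, t <= 0 -> psi t = 0).
Hypothesis psi_L1 : L1 psi.
Variable M : R.
Hypothesis HM : forall N, 1 < N ->
  (supconv_norm S (rhausdorff psi (truncinv N)) <= M%:E * supconv_norm S (truncinv N))%E.

Let cut (K : R) (t : R) : R := psi t * \1_(`[K^-1, K]%classic) t.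

Let cut_L1 K : L1 (cut K).
Proof.
apply: (@integrable_bounded_mul _ _ _ 1) => // t.
by rewrite indicE ger0_norm// lern1 leq_b1.
Qed.

Let cut_ge0 K t : 0 <= cut K t.
Proof. by rewrite mulr_ge0. Qed.

Let rhausdorff_add (psi1 psi2 : R -> R) N x : 0 < N -> L1 psi1 -> L1 psi2 ->
  (forall t, t <= 0 -> psi1 t = 0) -> (forall t, t <= 0 -> psi2 t = 0) ->
  rhausdorff (fun t => psi1 t + psi2 t) (truncinv N) x =
  rhausdorff psi1 (truncinv N) x + rhausdorff psi2 (truncinv N) x.
Proof.
move=> N0 i1 i2 p1 p2.
rewrite -RintegralD//; [|exact: rhausdorff_truncinv_integrand..].
by apply: eq_Rintegral => t _; rewrite mulrDl mulrDr.
Qed.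

(* Write [psi] as the sum of [cut K] and a tail: the first part is almost scalar
   on [truncinv N] and the second is controlled by its integral, up to an error
   that is negligible against the norm of [truncinv N]. *)
Let cut_bound K : 1 < K ->
  \int[mu]_t cut K t <= M + (\int[mu]_t psi t - \int[mu]_t cut K t).
Proof.
move=> K1.
pose tail t := psi t - cut K t.
have tail_L1 : L1 tail.
  have := integrable_add psi_L1 (integrable_scale (-1) (cut_L1 K)).
  by apply: eq_integrable => // t _ /=; rewrite mulN1r.
have tail_ge0 t : 0 <= tail t.
  by rewrite subr_ge0 ler_piMr// indicE lern1 leq_b1.
have cut_le0 t : t <= 0 -> cut K t = 0 by move=> t0; rewrite /cut psi_le0// mul0r.
have tail_le0 t : t <= 0 -> tail t = 0.
  by move=> t0; rewrite /tail psi_le0// cut_le0// subrr.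
rewrite -RintegralB//.
have cut_supp t : ~~ (K^-1 <= t <= K) -> cut K t = 0.
  by move=> tK; rewrite /cut indicE mem_setE in_itv/= (negbTE tK) mulr0.
have [C HC] :=
  supconv_norm_rhausdorff_almost_eigen (cut_ge0 K) (cut_L1 K) K1 cut_supp HS.
have [c c0 Hc] := supconv_norm_truncinv_ge HS.
set I1 := \int[mu]_t cut K t in HC *.
set I2 := \int[mu]_x (psi x - cut K x).
have main N : 1 < N -> (I1 - M - I2) * fine (supconv_norm S (truncinv N)) <= C.
  move=> N1; have N0 : 0 < N by rewrite (lt_trans _ N1).
  have ci := integrable_truncinv N.
  have sfin : supconv_norm S (truncinv N) \is a fin_num.
    by rewrite ge0_fin_numE ?(supconv_norm_truncinv_lty HS)// (supconv_norm_ge0 HS).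
  have hp := rhausdorff_integrable psi_ge0 psi_le0 psi_L1 ci.
  have ht := rhausdorff_integrable tail_ge0 tail_le0 tail_L1 ci.
  have split_cut : rhausdorff (cut K) (truncinv N) =
      (fun x => rhausdorff psi (truncinv N) x + (-1) * rhausdorff tail (truncinv N) x).
    apply/funext => x.
    have -> : rhausdorff psi (truncinv N) x =
        rhausdorff (cut K) (truncinv N) x + rhausdorff tail (truncinv N) x.
      rewrite -rhausdorff_add//.
      by congr (rhausdorff _ _ _); apply/funext => t; rewrite /tail addrC subrK.
    by rewrite mulN1r addrK.
  have := HC N N1; rewrite split_cut.
  have tl : (supconv_norm S (fun x => (-1) * rhausdorff tail (truncinv N) x)%R <=
      I2%:E * supconv_norm S (truncinv N))%E.
    rewrite (supconv_normZ HS (-1) ht) normrN1 mul1e.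
    apply: (le_trans (supconv_norm_rhausdorff tail_ge0 tail_le0 tail_L1 ci HS)).
    by rewrite /I2 /Rintegral fineK ?(integrable_fin_num _ tail_L1).
  have := supconv_normD HS hp (integrable_scale (-1) ht).
  move=> /le_trans /(_ (leeD (HM N1) tl)) h1 h2.
  have := le_trans h2 (leeD2r C%:E h1).
  rewrite -(fineK sfin) -!EFinM -!EFinD lee_fin; lra.
rewrite leNgt; apply/negP => lt.
have d0 : 0 < I1 - M - I2 by lra.
have C0 : 0 <= C.
  have := main 2 (ltr1n _ 2); apply: le_trans; rewrite mulr_ge0 ?(ltW d0)//.
  by rewrite fine_ge0// (supconv_norm_ge0 HS)//; exact: integrable_truncinv.
(* With [N = expR l], the lower bound [c * ln N] makes the left-hand side of
   [main] at least [C + 1]. *)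
pose l := (C + 1) / (c * (I1 - M - I2)).
have l0 : 0 < l by rewrite divr_gt0 ?mulr_gt0// ltr_wpDl.
have N1 : 1 < expR l by rewrite expR_gt1.
have N0 : 0 < expR l by exact: expR_gt0.
have ci := integrable_truncinv (expR l).
have sfin : supconv_norm S (truncinv (expR l)) \is a fin_num.
  by rewrite ge0_fin_numE ?(supconv_norm_truncinv_lty HS)// (supconv_norm_ge0 HS).
have := Hc _ N1; rewrite expRK -(fineK sfin) lee_fin => h1.
have := main _ N1; apply/negP; rewrite -ltNge.
apply: (@lt_le_trans _ _ ((I1 - M - I2) * (c * l))); last by rewrite ler_wpM2l// ltW.
suff -> : (I1 - M - I2) * (c * l) = C + 1 by rewrite ltrDl.
by rewrite /l; field; rewrite !gt_eqF.
Qed.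

Let cut_cvg : \int[mu]_t cut n.+2%:R t @[n --> \oo] --> \int[mu]_t psi t.
Proof.
have cv : (\int[mu]_t (cut n.+2%:R t)%:E @[n --> \oo] --> \int[mu]_t (psi t)%:E)%E.
  have [//|||||_ _ //] := @dominated_convergence _ _ _ mu setT measurableT
    (fun n t => (cut n.+2%:R t)%:E) (EFin \o psi) (EFin \o psi).
  - by move=> n; exact: measurable_int (cut_L1 _).
  - exact: measurable_int psi_L1.
  - apply: aeW => t _; apply/fine_cvgP; split => /=; first exact: nearW.
    apply: cvg_near_cst; near=> n.
    have [t0|t0] := leP t 0; first by rewrite /cut/= psi_le0// mul0r.
    have le2 (r : R) : r <= n%:R -> r <= n.+2%:R.
      by move=> /le_trans; apply; rewrite ler_nat -addn2 leq_addr.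
    rewrite /cut/= indicE mem_set ?mulr1//= in_itv/=; apply/andP; split.
      rewrite -[leRHS]invrK lef_pV2 ?posrE ?invr_gt0//; apply: le2.
      by near: n; exact: nbhs_infty_ger.
    by apply: le2; near: n; exact: nbhs_infty_ger.
  - exact: psi_L1.
  - apply: aeW => t n _ /=.
    by rewrite lee_fin ger0_norm// ler_piMr// indicE lern1 leq_b1.
rewrite -(fineK (integrable_fin_num _ psi_L1))// in cv.
exact: fine_cvg cv.
Unshelve. all: by end_near. Qed.

(** With [I] the integral of [psi] and [I_n] that of its cutoff, [cut_bound]
    reads [I_n <= M + (I - I_n)], where [I - I_n] bounds the operator of the
    tail.  In the limit this is [I + I <= M + I]. *)
Lemma Rintegral_le_rhausdorff_bound : \int[mu]_t psi t <= M.
Proof.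
set I := \int[mu]_t psi t.
have : I + I <= M + I.
  apply: (cvgr_to_le (cvgD cut_cvg cut_cvg)); apply: nearW => n /=.
  have := @cut_bound n.+2%:R (ltr1n _ _); rewrite -/I => h.
  by move: h; set a := Rintegral _ _ _ => h; change (a + a <= M + I); lra.
lra.
Qed.

End norm_comparison.

(** * Kernels coming from Schwartz functions *)

Section schwartz_kernels.
Context (R : realType).
Local Notation mu := (@lebesgue_measure R).
Local Notation L1 f := (mu.-integrable setT (EFin \o f)).
Implicit Types (f g h k : R -> R).

Lemma rschwartz_decay h n : rschwartz h ->
  exists2 C, 0 <= C &
    forall x, `|derive1n n h x| <= C /\ `|x| ^+ 2 * `|derive1n n h x| <= C.
Proof.
move=> [_ dec]; have [C0 H0] := dec 0%N n; have [C2 H2] := dec 2%N n.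
exists (Num.max C0 C2).
  by have := H0 0; rewrite expr0 mul1r le_max => /(le_trans (normr_ge0 _)) ->.
by move=> x; have := H0 x; rewrite expr0 mul1r !le_max => ->; rewrite H2 orbT.
Qed.

Lemma rschwartz_continuous h : rschwartz h -> continuous h.
Proof.
move=> [dh _] x; apply: differentiable_continuous; apply/derivable1_diffP.
exact: (dh 0%N x).
Qed.

Lemma rschwartz_integrable h : rschwartz h -> L1 h.
Proof.
move=> hh; have [C C0 HC] := rschwartz_decay 0 hh.
have di : L1 (fun x : R => 2 * C * (oneDsqr x)^-1).
  exact: integrable_scale (@integrable_oneDsqrV R).
apply: integrable_dominated di.
  exact: continuous_measurable_fun (rschwartz_continuous hh).
move=> x; have [H0 H2] := HC x.
rewrite ler_pdivlMr; last by rewrite (lt_le_trans ltr01)// oneDsqr_ge1.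
rewrite /oneDsqr -real_normK ?num_real//.
move: H0 H2; rewrite derive1n0; lra.
Qed.

Lemma rschwartz_mvt h u v : rschwartz h ->
  exists2 c, `|c - v| <= `|u - v| & `|h u - h v| = `|derive1n 1 h c| * `|u - v|.
Proof.
move=> hh; have dh : forall x : R, is_derive x (1 : R) h (derive1n 1 h x).
  by move=> x; rewrite derive1n1 derive1E; apply: derivableP; exact: (hh.1 0%N x).
have cw a b : {within `[a, b], continuous h}.
  by apply: continuous_subspaceT => x; exact: rschwartz_continuous.
have [uv|vu] := leP u v.
- have [c] := MVT_segment uv (fun x _ => dh x) (cw u v).
  rewrite in_itv/= => /andP[uc cv] e; exists c.
    by rewrite !ler0_norm ?subr_le0//; lra.
  by rewrite distrC e normrM (distrC v).
- have [c] := MVT_segment (ltW vu) (fun x _ => dh x) (cw v u).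
  rewrite in_itv/= => /andP[vc cu] e; exists c.
    by rewrite !ger0_norm ?subr_ge0 ?(ltW vu)//; lra.
  by rewrite e normrM.
Qed.

Lemma rschwartz_lipschitz h : rschwartz h ->
  exists2 C, 0 <= C & forall u v, `|h u - h v| <= C * `|u - v|.
Proof.
move=> hh; have [C C0 HC] := rschwartz_decay 1 hh; exists C => // u v.
have [c _ ->] := rschwartz_mvt u v hh.
by rewrite ler_wpM2r//; have [] := HC c.
Qed.

(** The mean value theorem, with the decay [|h' c| <= C / c ^+ 2] at a point
    satisfying [|v| / 2 <= |c|]. *)
Lemma rschwartz_smooth h : rschwartz h ->
  exists2 C, 0 <= C & forall v w, 2 * `|w| <= `|v| ->
    `|h (v - w) - h v| <= C * `|w| / v ^+ 2.
Proof.
move=> hh; have [C C0 HC] := rschwartz_decay 1 hh.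
exists (4 * C); first by rewrite mulr_ge0.
move=> v w wv.
have [c] := rschwartz_mvt (v - w) v hh.
have -> : v - w - v = - w by ring.
rewrite normrN => cv ->.
have [v0|v0] := eqVneq v 0.
  have w0 : `|w| = 0.
    by apply/eqP; rewrite eq_le normr_ge0 andbT; move: wv; rewrite v0 normr0; lra.
  by rewrite w0 !mulr0 mul0r.
have v2 : 0 < v ^+ 2 by rewrite exprn_even_gt0.
rewrite ler_pdivlMr// mulrAC ler_wpM2r//.
have [_ H2] := HC c.
have cv2 : `|v| / 2 <= `|c|.
  by have := lerB_dist v c; rewrite distrC; lra.
have : (`|v| / 2) ^+ 2 <= `|c| ^+ 2.
  by rewrite ler_sqr ?nnegrE// divr_ge0.
rewrite -[v ^+ 2]real_normK ?num_real// expr_div_n => h1.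
have := ler_wpM2r (normr_ge0 (derive1n 1 h c)) h1.
have -> : `|v| ^+ 2 / 2 ^+ 2 * `|derive1n 1 h c| = (`|derive1n 1 h c| * `|v| ^+ 2) / 4.
  by field.
lra.
Qed.

(** With [h1] and [h2] the real and imaginary parts of a complex kernel, these
    are the real parts of its dilates multiplied by scalars of modulus at most
    [1]. *)
Definition kernels (h1 h2 : R -> R) : set (R -> R) :=
  [set k | exists a b t, [/\ 0 < t, a ^+ 2 + b ^+ 2 <= 1 &
    k = dilate t (fun z => a * h1 z + b * h2 z)]].

Lemma unit_disc_le1 (a b : R) : a ^+ 2 + b ^+ 2 <= 1 -> `|a| <= 1 /\ `|b| <= 1.
Proof.
move=> ab; have := sqr_ge0 a; have := sqr_ge0 b => b0 a0.
split.
  by rewrite -(@expr_le1 _ 2)// real_normK ?num_real//; lra.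
by rewrite -(@expr_le1 _ 2)// real_normK ?num_real//; lra.
Qed.

Lemma ler_norm_comb (a b u v : R) : a ^+ 2 + b ^+ 2 <= 1 ->
  `|a * u + b * v| <= `|u| + `|v|.
Proof.
move=> /unit_disc_le1[a1 b1]; rewrite (le_trans (ler_normD _ _))// !normrM.
by rewrite lerD// ler_piMl.
Qed.

(** The estimates on [h1] and [h2] pass to their combinations over the unit disc
    with the same constants, and to dilates by scale invariance.  A combination
    of positive integral is a component of nonzero integral times its sign. *)
Lemma kernel_family_schwartz h1 h2 : rschwartz h1 -> rschwartz h2 ->
  (\int[mu]_x h1 x, \int[mu]_x h2 x) <> (0, 0) -> kernel_family (kernels h1 h2).
Proof.
move=> s1 s2 h0.
have i1 := rschwartz_integrable s1; have i2 := rschwartz_integrable s2.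
have ic a b : L1 (fun z => a * h1 z + b * h2 z).
  by apply: integrable_add; exact: integrable_scale.
split.
- move=> _ [a [b [t [t0 ab ->]]]].
  have [C1 C10 H1] := rschwartz_decay 0 s1; have [C2 C20 H2] := rschwartz_decay 0 s2.
  exists (t^-1 * (C1 + C2)) => x; rewrite /dilate normrM gtr0_norm ?invr_gt0//.
  rewrite ler_wpM2l ?invr_ge0 ?(ltW t0)// (le_trans (ler_norm_comb _ _ ab))//.
  by rewrite lerD//; [have [] := H1 (x / t)|have [] := H2 (x / t)].
- move=> _ [a [b [t [t0 ab ->]]]].
  have [C1 C10 H1] := rschwartz_lipschitz s1; have [C2 C20 H2] := rschwartz_lipschitz s2.
  exists (t^-1 * ((C1 + C2) * t^-1)) => x y.
  rewrite /dilate -mulrBr normrM gtr0_norm ?invr_gt0//.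
  rewrite -mulrA ler_wpM2l ?invr_ge0 ?(ltW t0)//.
  rewrite (_ : a * _ + _ - _ =
    a * (h1 (x / t) - h1 (y / t)) + b * (h2 (x / t) - h2 (y / t))); last by ring.
  rewrite (le_trans (ler_norm_comb _ _ ab))// mulrDl mulrDl.
  have e : t^-1 * `|x - y| = `|x / t - y / t|.
    by rewrite -mulrBl normrM normfV (gtr0_norm t0) mulrC.
  by rewrite -!mulrA e lerD.
- move=> _ [a [b [t [t0 ab ->]]]]; exists (- a), (- b), t; split => //.
    by rewrite !sqrrN.
  by apply/funext => z; rewrite /dilate; ring.
- move=> _ s [a [b [t [t0 ab ->]]]] sp; exists a, b, (s * t); split => //.
    exact: mulr_gt0.
  by apply/funext => z; rewrite /dilate invfM !mulrA.
- exists (\int[mu]_x `|h1 x| + \int[mu]_x `|h2 x|) => _ [a [b [t [t0 ab ->]]]].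
  have kL : L1 (dilate t (fun z => a * h1 z + b * h2 z)) by exact: dilate_integrable.
  split => //.
  have -> : \int[mu]_x `|dilate t (fun z => a * h1 z + b * h2 z) x| =
            \int[mu]_x `|a * h1 x + b * h2 x|.
    have := @Rintegral_affine R t^-1 0 (fun x => `|a * h1 x + b * h2 x|).
    rewrite invr_eq0 gt_eqF// => /(_ isT (integrable_norm (ic a b))).
    rewrite gtr0_norm ?invr_gt0// invrK => e.
    transitivity (t^-1 * (t * \int[mu]_x `|a * h1 x + b * h2 x|)); last first.
      by rewrite mulrA mulVf ?gt_eqF// mul1r.
    rewrite -e -RintegralZl//; last first.
      apply: (@integrable_affine R t^-1 0 (fun x => `|a * h1 x + b * h2 x|)).
        by rewrite invr_eq0 gt_eqF.
      exact: integrable_norm (ic a b).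
    apply: eq_Rintegral => x _; rewrite /dilate normrM gtr0_norm ?invr_gt0//.
    by rewrite addr0 (mulrC t^-1 x).
  rewrite -RintegralD//; [|exact: integrable_norm..].
  apply: le_Rintegral => //.
  + exact: integrable_norm (ic a b).
  + by apply: integrable_add; exact: integrable_norm.
  + by move=> x _; exact: ler_norm_comb.
- have [C1 C10 H1] := rschwartz_smooth s1; have [C2 C20 H2] := rschwartz_smooth s2.
  exists (C1 + C2) => _ x y [a [b [t [t0 ab ->]]]] xy.
  have t1 : t != 0 by rewrite gt_eqF.
  have xyt : 2 * `|y / t| <= `|x / t| by rewrite !normrM mulrA ler_wpM2r.
  rewrite /dilate -mulrBr normrM gtr0_norm ?invr_gt0//.
  have -> : (x - y) / t = x / t - y / t by rewrite mulrBl.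
  rewrite (_ : a * _ + _ - _ = a * (h1 (x / t - y / t) - h1 (x / t)) +
    b * (h2 (x / t - y / t) - h2 (x / t))); last by ring.
  apply: (@le_trans _ _ (t^-1 * ((C1 + C2) * `|y / t| / (x / t) ^+ 2))).
    rewrite ler_wpM2l ?invr_ge0 ?(ltW t0)// (le_trans (ler_norm_comb _ _ ab))//.
    by rewrite !mulrDl lerD//; [exact: H1|exact: H2].
  rewrite normrM normfV (gtr0_norm t0) expr_div_n invfM invrK le_eqVlt; apply/orP; left.
  by apply/eqP; set z := (x ^+ 2)^-1; field.
- have [p0|p0] := eqVneq (\int[mu]_x h1 x) 0; last first.
    exists (dilate 1 (fun z => Num.sg (\int[mu]_x h1 x) * h1 z + 0 * h2 z)).
      exists (Num.sg (\int[mu]_x h1 x)), 0, 1; split => //.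
      by rewrite sqr_sg p0 expr0n/= addr0.
    under eq_Rintegral do rewrite /dilate invr1 mul1r mulr1 mul0r addr0.
    by rewrite RintegralZl// -normrEsg normr_gt0.
  have q0 : \int[mu]_x h2 x != 0 by apply/eqP => q0; apply: h0; rewrite p0 q0.
  exists (dilate 1 (fun z => 0 * h1 z + Num.sg (\int[mu]_x h2 x) * h2 z)).
    exists 0, (Num.sg (\int[mu]_x h2 x)), 1; split => //.
    by rewrite sqr_sg q0 expr0n/= add0r.
  under eq_Rintegral do rewrite /dilate invr1 mul1r mulr1 mul0r add0r.
  by rewrite RintegralZl// -normrEsg normr_gt0.
Qed.

End schwartz_kernels.

(** * Complex maximal functions of real functions *)

Section complex_maximal_function.
Context (R : realType).
Local Notation mu := (@lebesgue_measure R).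
Local Notation L1 f := (mu.-integrable setT (EFin \o f)).
Implicit Types (f g h k : R -> R).

Variables (Phi : R -> R[i]) (phi : R -> R).
Hypotheses (Phi_schwartz : schwartz Phi) (Phi_int : cintegral setT Phi <> 0).

Definition complexify f (x : R) : R[i] := real_complex R (f x).

Definition Phi_kernels : set (R -> R) :=
  kernels (fun x => complex.Re (Phi x)) (fun x => complex.Im (Phi x)).

Lemma kernel_family_Phi : kernel_family Phi_kernels.
Proof.
have [sr si] := Phi_schwartz.
apply: kernel_family_schwartz => // - [r0 i0]; apply: Phi_int.
by rewrite /cintegral r0 i0.
Qed.

Lemma kernel_Phi a b t : 0 < t -> a ^+ 2 + b ^+ 2 <= 1 ->
  Phi_kernels (dilate t (fun z => a * complex.Re (Phi z) + b * complex.Im (Phi z))).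
Proof. by move=> t0 ab; exists a, b, t. Qed.

Lemma unit_disc_dual (u v : R) :
  exists a b : R, a ^+ 2 + b ^+ 2 <= 1 /\ a * u + b * v = Normc.normc (Complex u v).
Proof.
rewrite /=; set n := Num.sqrt _.
have n2 : n ^+ 2 = u ^+ 2 + v ^+ 2 by rewrite sqr_sqrtr// addr_ge0 ?sqr_ge0.
have [n0|n0] := eqVneq n 0.
  by exists 0, 0; rewrite !mul0r addr0 expr0n/= addr0 ler01.
exists (u / n), (v / n); split.
  by rewrite !expr_div_n -mulrDl -n2 mulfV// expf_neq0.
by rewrite mulrAC (mulrAC v) -mulrDl -!expr2 -n2 expr2 mulfK.
Qed.

Lemma ler_unit_disc (a b u v : R) : a ^+ 2 + b ^+ 2 <= 1 ->
  a * u + b * v <= Normc.normc (Complex u v).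
Proof.
move=> ab /=; apply: (le_trans (ler_norm _)); rewrite -sqrtr_sqr ler_wsqrtr//.
have := sqr_ge0 (a * v - b * u); have := sqr_ge0 u; have := sqr_ge0 v; nra.
Qed.

Lemma convolution_complexify f t x : 0 < t -> L1 f ->
  forall a b, a ^+ 2 + b ^+ 2 <= 1 ->
  conv f (dilate t (fun z => a * complex.Re (Phi z) + b * complex.Im (Phi z))) x =
  a * complex.Re (convolution (complexify f) (dilation Phi t) x) +
  b * complex.Im (convolution (complexify f) (dilation Phi t) x).
Proof.
move=> t0 fi a b ab.
have HS := kernel_family_Phi.
have kr : Phi_kernels (dilate t (fun z => 1 * complex.Re (Phi z) + 0 * complex.Im (Phi z))).
  by apply: kernel_Phi => //; rewrite expr1n expr0n/= addr0.
have ki : Phi_kernels (dilate t (fun z => 0 * complex.Re (Phi z) + 1 * complex.Im (Phi z))).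
  by apply: kernel_Phi => //; rewrite expr1n expr0n/= add0r.
have ir := conv_integrable HS x fi kr.
have ii := conv_integrable HS x fi ki.
have er : complex.Re (convolution (complexify f) (dilation Phi t) x) =
    conv f (dilate t (fun z => 1 * complex.Re (Phi z) + 0 * complex.Im (Phi z))) x.
  rewrite /convolution /cintegral /=; apply: eq_Rintegral => y _.
  by rewrite /dilation /dilate /complexify; case: (Phi _) => u v /=; ring.
have ei : complex.Im (convolution (complexify f) (dilation Phi t) x) =
    conv f (dilate t (fun z => 0 * complex.Re (Phi z) + 1 * complex.Im (Phi z))) x.
  rewrite /convolution /cintegral /=; apply: eq_Rintegral => y _.
  by rewrite /dilation /dilate /complexify; case: (Phi _) => u v /=; ring.
rewrite er ei -!RintegralZl// -RintegralD//; [|exact: integrable_scale..].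
by apply: eq_Rintegral => y _; rewrite /dilate; ring.
Qed.

(** By [unit_disc_dual] and [ler_unit_disc], the modulus is the supremum of
    [a * Re z + b * Im z] over the unit disc; this supremum and the one over the
    scales [t] merge into a single one. *)
Lemma maximal_complexify f x : L1 f ->
  maximal Phi (complexify f) x = supconv Phi_kernels f x.
Proof.
move=> fi; apply/eqP; rewrite eq_le; apply/andP; split.
- apply: ge_ereal_sup => _ [t tpos <-].
  have t0 : 0 < t by move: tpos; rewrite /= in_itv/= andbT.
  have := convolution_complexify x t0 fi.
  case: (convolution _ _ _) => u v /= h.
  have [a [b [ab /= <-]]] := unit_disc_dual u v.
  rewrite -(h a b ab); apply: ereal_sup_ubound.
  by eexists; [exact: (kernel_Phi t0 ab)|].
- apply: ge_ereal_sup => _ [_ [a [b [t [t0 ab ->]]]] <-].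
  rewrite (convolution_complexify x t0 fi ab).
  apply: (@le_trans _ _ (Normc.normc (convolution (complexify f) (dilation Phi t) x))%:E).
    by case: (convolution _ _ _) => u v; rewrite lee_fin ler_unit_disc.
  by apply: ereal_sup_ubound; exists t => //=; rewrite in_itv/= andbT.
Qed.

Lemma hardy_norm_complexify f : L1 f ->
  hardy_norm Phi (complexify f) = supconv_norm Phi_kernels f.
Proof. by move=> fi; apply: eq_integral => x _; exact: maximal_complexify. Qed.

Lemma hardy_complexify f : L1 f -> (supconv_norm Phi_kernels f < +oo)%E ->
  hardy Phi (complexify f).
Proof.
move=> fi fl; split; last by rewrite hardy_norm_complexify.
split => //=; exact: integrable0.
Qed.

Let psi := phi \_ `]0, +oo[.

Lemma hausdorff_complexify f :
  hausdorff phi (complexify f) = complexify (rhausdorff psi f).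
Proof.
apply/funext => x; rewrite /hausdorff /cintegral.
rewrite -[RHS]/(Complex (rhausdorff psi f x) 0).
congr Complex.
- rewrite Rintegral_mkcond; apply: eq_Rintegral => t _.
  rewrite /psi !patchE; case: ifPn => _ /=; first by ring.
  by rewrite mul0r mulr0.
- rewrite (_ : (fun _ => _) = cst 0); first by rewrite Rintegral_cst// mul0r.
  by apply/funext => t /=; ring.
Qed.

End complex_maximal_function.

(** * Conclusion *)

Theorem corollary1p1 (R : realType) (Phi : R -> R[i]) (phi : R -> R)
    (Phi_schwartz : schwartz Phi)
    (Phi_int : cintegral setT Phi <> 0)
    (phi_ge0 : forall t : R, 0 < t -> 0 <= phi t)
    (phi_loc : locally_integrable `]0, +oo[ phi)
    (H_bounded : hausdorff_bounded Phi phi) :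
  (\int[lebesgue_measure]_(t in `]0%R, +oo[) (phi t)%:E
     <= hausdorff_opnorm Phi phi)%E /\
  (hausdorff_opnorm Phi phi < +oo)%E.
Proof.
have HS := kernel_family_Phi Phi_schwartz Phi_int.
(* The continuity constant may be negative, hence the absolute value. *)
have opfin : (hausdorff_opnorm Phi phi < +oo)%E.
  have [C HC] := hausdorff_continuous H_bounded.
  apply: (@le_lt_trans _ _ (`|C|)%:E); last exact: ltry.
  apply: ge_ereal_sup => _ [f [hf f1] <-]; apply: (le_trans (HC f hf)).
  have f0 : (0 <= hardy_norm Phi f)%E.
    apply: integral_ge0 => x _.
    apply: (@le_trans _ _ (Normc.normc (convolution f (dilation Phi 1) x))%:E).
      by rewrite lee_fin; case: (convolution _ _ _) => u v; exact: sqrtr_ge0.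
    by apply: ereal_sup_ubound; exists 1 => //=; rewrite in_itv/= ltr01.
  apply: (@le_trans _ _ (`|C|%:E * hardy_norm Phi f)%E).
    by apply: lee_wpmul2r => //; rewrite lee_fin ler_norm.
  by rewrite -[leRHS]mule1; apply: lee_wpmul2l.
split=> //.
pose psi := phi \_ `]0, +oo[.
have psiE t : 0 < t -> psi t = phi t.
  by move=> t0; rewrite /psi patchE mem_set//= in_itv/= t0.
have psi_le0 t : t <= 0 -> psi t = 0.
  by move=> t0; rewrite /psi patchE memNset//= in_itv/= andbT; apply/negP; rewrite -leNgt.
have psi_ge0 t : 0 <= psi t.
  by have [t0|t0] := ltP 0 t; [rewrite psiE// phi_ge0|rewrite psi_le0].
have [phi_meas _ phi_compact] := phi_loc.
have psi_meas : measurable_fun setT psi.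
  exact: (measurable_restrictT _ _).1.
have psi_loc a b : 0 < a -> (\int[lebesgue_measure]_(t in `[a, b]) (psi t)%:E < +oo)%E.
  move=> a0.
  have sub : `[a, b]%classic `<=` `]0%R, +oo[%classic.
    by move=> t /=; rewrite !in_itv/= andbT => /andP[/(lt_le_trans a0)].
  have := phi_compact _ sub (@segment_compact R a b).
  apply: le_lt_trans; rewrite le_eqVlt; apply/orP; left; apply/eqP.
  apply: eq_integral => t; rewrite inE => /sub; rewrite /= in_itv/= andbT => t0.
  by rewrite psiE// ger0_norm// phi_ge0.
have c_hardy N : 0 < N -> hardy Phi (complexify (truncinv N)).
  move=> N0; apply: hardy_complexify => //; first exact: integrable_truncinv.
  exact: supconv_norm_truncinv_lty.
have rhausdorff_L1 N : 0 < N ->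
    lebesgue_measure.-integrable setT (EFin \o rhausdorff psi (truncinv N)).
  move=> N0; have := hausdorff_hardy H_bounded (c_hardy N N0).
  by rewrite hausdorff_complexify => -[[]].
have psi_L1 : lebesgue_measure.-integrable setT (EFin \o psi).
  exact: integrable_of_rhausdorff (rhausdorff_L1 2 _).
(* The operator norm is tested on [truncinv N] divided by its norm [s]. *)
have normalized N : 1 < N -> exists2 s : R, 0 < s &
    supconv_norm (Phi_kernels Phi) (truncinv N) = s%:E /\
    (s^-1%:E * supconv_norm (Phi_kernels Phi) (rhausdorff psi (truncinv N)) <=
     hausdorff_opnorm Phi phi)%E.
  move=> N1; have N0 : 0 < N by rewrite (lt_trans _ N1).
  have ci := integrable_truncinv N.
  have s_fin : supconv_norm (Phi_kernels Phi) (truncinv N) \is a fin_num.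
    by rewrite ge0_fin_numE ?(supconv_norm_truncinv_lty HS)// (supconv_norm_ge0 HS).
  have [c c0 Hc] := supconv_norm_truncinv_ge HS.
  set s := fine (supconv_norm (Phi_kernels Phi) (truncinv N)).
  have sE : supconv_norm (Phi_kernels Phi) (truncinv N) = s%:E by rewrite fineK.
  have s0 : 0 < s.
    by have := Hc N N1; rewrite sE lee_fin; apply: lt_le_trans; rewrite mulr_gt0// ln_gt0.
  exists s => //; split => //.
  have si0 : `|s^-1| = s^-1 by rewrite gtr0_norm// invr_gt0.
  have sci := integrable_scale s^-1 ci.
  have scn : supconv_norm (Phi_kernels Phi) (fun y => s^-1 * truncinv N y) = 1%E.
    by rewrite (supconv_normZ HS)// si0 sE -EFinM mulVf// gt_eqF.
  apply: ereal_sup_ubound; exists (complexify (fun y => s^-1 * truncinv N y)).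
    split; last by rewrite hardy_norm_complexify// scn.
    by apply: hardy_complexify => //; rewrite scn ltry.
  have scaled : rhausdorff psi (fun y => s^-1 * truncinv N y) =
      (fun x => s^-1 * rhausdorff psi (truncinv N) x).
    apply/funext => x; rewrite -RintegralZl//; last exact: rhausdorff_truncinv_integrand.
    by apply: eq_Rintegral => t _; rewrite -mulrA.
  rewrite hausdorff_complexify scaled hardy_norm_complexify//; last first.
    exact: integrable_scale (rhausdorff_L1 N N0).
  by rewrite (supconv_normZ HS) ?si0//; exact: rhausdorff_L1.
have opE : (fine (hausdorff_opnorm Phi phi))%:E = hausdorff_opnorm Phi phi.
  rewrite fineK// ge0_fin_numE//.
  have [s s0 [_]] := normalized 2 (ltr1n _ 2); apply: le_trans.
  rewrite mule_ge0 ?lee_fin ?invr_ge0 ?(ltW s0)//.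
  by apply: (supconv_norm_ge0 HS); exact: rhausdorff_L1.
have -> : (\int[lebesgue_measure]_(t in `]0%R, +oo[) (phi t)%:E =
           (\int[lebesgue_measure]_t psi t)%:E)%E.
  rewrite /Rintegral fineK; last exact: integrable_fin_num psi_L1.
  rewrite [LHS]integral_mkcond; congr (integral _ _ _).
  by rewrite restrict_EFin.
rewrite -opE lee_fin; apply: (Rintegral_le_rhausdorff_bound HS) => // N N1.
have [s s0 [sE]] := normalized N N1; rewrite opE sE => h.
have -> : supconv_norm (Phi_kernels Phi) (rhausdorff psi (truncinv N)) =
    (s%:E * (s^-1%:E * supconv_norm (Phi_kernels Phi) (rhausdorff psi (truncinv N))))%E.
  by rewrite muleA -EFinM mulfV ?mul1e// gt_eqF.
by rewrite [leRHS]muleC; apply: lee_wpmul2l => //; rewrite lee_fin ltW.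
Qed.
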